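(* $\mathrm{EQMA}(1)\subseteq\mathrm{RQMA}(1)\subseteq\mathrm{NQMA}(1)=\mathrm{NQP}$.
   Context: A (promise) problem is a pair $A=(A_{\rm yes},A_{\rm no})$ of disjoint sets of binary strings. A quantum verifier for $k$-proof quantum Merlin-Arthur proof systems is a polynomial-time computable map $x\mapsto V(x)$, where $V(x)$ is a description of a quantum circuit over a fixed reasonable universal finite gate set. $V(x)$ acts on a work register of $q_{\mathcal V}(|x|)$ qubits (one designated output qubit) and on $k(|x|)$ witness registers of $q_{\mathcal M}(|x|)$ qubits each, for polynomially bounded $q_{\mathcal V},q_{\mathcal M}$. A quantum proof is a pure state of $q_{\mathcal M}(|x|)$ qubits. Given proofs $|\phi_1\rangle,\dots,|\phi_{k(|x|)}\rangle$, the acceptance probability is the probability that measuring the output qubit yields $1$ after $V(x)$ is applied to $|0\cdots0\rangle\otimes|\phi_1\rangle\otimes\cdots\otimes|\phi_{k(|x|)}\rangle$. For functions $c,s:\mathbb{Z}^{+}\to[0,1]$, $A\in\mathrm{QMA}(k,c,s)$ iff there is such a verifier with: for $x\in A_{\rm yes}$ some $k(|x|)$ proofs give acceptance probability $\ge c(|x|)$, and for $x\in A_{\rm no}$ all $k(|x|)$ proofs give acceptance probability $\le s(|x|)$. Define $\mathrm{EQMA}(k)=\mathrm{QMA}(k,1,0)$, $\mathrm{RQMA}(k)=\mathrm{QMA}(k,\tfrac12,0)$, and $\mathrm{NQMA}(k)$ as the class of problems $A$ such that $A\in\mathrm{QMA}(k,c,0)$ for some function $c:\mathbb{Z}^{+}\to(0,1]$.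 $\mathrm{NQP}$ is the class of problems $A$ for which there is a polynomial-time uniformly generated family of quantum circuits $\{Q_x\}$ (same gate set), applied to an all-zero initial state and followed by measurement of an output qubit, such that $Q_x$ accepts with nonzero probability for every $x\in A_{\rm yes}$ and with probability zero for every $x\in A_{\rm no}$. *)

(* Defs.v *)
From HB Require Import structures.
From mathcomp Require Import all_boot all_order all_algebra.
From mathcomp Require Import reals.
From mathcomp Require Import complex.
Set Implicit Arguments. Unset Strict Implicit. Unset Printing Implicit Defensive.
Import Order.TTheory GRing.Theory Num.Theory.
Local Open Scope ring_scope.

Record problem := Problem {
  yes : seq bool -> Prop;
  no : seq bool -> Prop;
  yes_no_disjoint : forall x, yes x -> no x -> False }.

Inductive move := MoveL | MoveR | MoveS.

Record TM := TMk {
  tm_ns : nat;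
  tm_start : 'I_tm_ns.+1;
  tm_halt : 'I_tm_ns.+1;
  tm_delta : 'I_tm_ns.+1 -> option bool -> 'I_tm_ns.+1 * option bool * move }.
Arguments tm_start : clear implicits.
Arguments tm_halt : clear implicits.
Arguments tm_delta : clear implicits.

(* configuration: state, left part of tape (nearest cell first), scanned
   symbol, right part of tape; None is the blank symbol *)
Record config (M : TM) := Config {
  cf_state : 'I_(tm_ns M).+1;
  cf_left : seq (option bool);
  cf_head : option bool;
  cf_right : seq (option bool) }.

Definition tm_step (M : TM) (c : config M) : config M :=
  if cf_state c == tm_halt M then c else
  let: (q', w, mv) := tm_delta M (cf_state c) (cf_head c) in
  match mv with
  | MoveS => @Config M q' (cf_left c) w (cf_right c)
  | MoveL => match cf_left c with
             | [::] => @Config M q' [::] None (w :: cf_right c)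
             | l :: ls => @Config M q' ls l (w :: cf_right c)
             end
  | MoveR => match cf_right c with
             | [::] => @Config M q' (w :: cf_left c) None [::]
             | r :: rs => @Config M q' (w :: cf_left c) r rs
             end
  end.

Definition tm_init (M : TM) (x : seq bool) : config M :=
  match x with
  | [::] => @Config M (tm_start M) [::] None [::]
  | b :: bs => @Config M (tm_start M) [::] (Some b) (map Some bs)
  end.

Fixpoint nonblank_prefix (s : seq (option bool)) : seq bool :=
  match s with
  | Some b :: s' => b :: nonblank_prefix s'
  | _ => [::]
  end.

Definition tm_output (M : TM) (c : config M) : seq bool :=
  nonblank_prefix (cf_head c :: cf_right c).

Definition PolyTime (f : seq bool -> seq bool) : Prop :=
  exists (M : TM) (a d : nat), forall x : seq bool,
    exists t : nat, (t <= a * (size x) ^ d + a)%N /\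
      let c := iter t (tm_step (M:=M)) (tm_init M x) in
      cf_state c = tm_halt M /\ tm_output c = f x.

Inductive gate := GH of nat | GT of nat | GCNOT of nat & nat.

(* description: work register size q_V (qubit 0 = output qubit), witness
   register size q_M, number k of witness registers, gate sequence.
   Qubits 0..q_V-1 are the work register, witness register j (j < k)
   consists of qubits q_V + j*q_M + t, t < q_M. *)
Record circ := Circ { cqV : nat; cqM : nat; ck : nat; cgates : seq gate }.

Definition nqubits (c : circ) : nat := (cqV c + ck c * cqM c)%N.

Definition gate_ok (N : nat) (g : gate) : bool :=
  match g with
  | GH i | GT i => (i < N)%N
  | GCNOT a b => [&& (a < N)%N, (b < N)%N & a != b]
  end.

Definition circ_ok (c : circ) : bool :=
  (0 < cqV c)%N && all (gate_ok (nqubits c)) (cgates c).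

(* encoding of descriptions as bit strings: a list of naturals, each n
   written in unary as 1^n 0; the list is [q_V; q_M; k; gates...] where a
   gate is 0 i (H on i), 1 i (T on i) or 2 a b (CNOT control a target b) *)
Fixpoint unary_nats (acc : nat) (s : seq bool) : option (seq nat) :=
  match s with
  | [::] => if acc is 0 then Some [::] else None
  | true :: s' => unary_nats acc.+1 s'
  | false :: s' => omap (cons acc) (unary_nats 0 s')
  end.

Fixpoint parse_gates (l : seq nat) : option (seq gate) :=
  match l with
  | [::] => Some [::]
  | 0 :: i :: r => omap (cons (GH i)) (parse_gates r)
  | 1 :: i :: r => omap (cons (GT i)) (parse_gates r)
  | 2 :: a :: b :: r => omap (cons (GCNOT a b)) (parse_gates r)
  | _ => None
  end.

Definition decode (s : seq bool) : option circ :=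
  match unary_nats 0 s with
  | Some (qv :: qm :: k :: gl) =>
      match parse_gates gl with
      | Some gs => let c := Circ qv qm k gs in if circ_ok c then Some c else None
      | None => None
      end
  | _ => None
  end.

Section Semantics.
Variable R : realType.
Local Notation C := (R[i]).

Definition bits (N : nat) := {ffun 'I_N -> bool}.

Definition bitn (N : nat) (b : bits N) (i : nat) : bool :=
  if (insub i : option 'I_N) is Some j then b j else false.

Definition setb (N : nat) (b : bits N) (i : nat) (v : bool) : bits N :=
  [ffun j : 'I_N => if nat_of_ord j == i then v else b j].

Definition sqn (z : C) : R := complex.Re z ^+ 2 + complex.Im z ^+ 2.

Definition invsqrt2 : R := (Num.sqrt (2 : R))^-1.

Definition Hent (u v : bool) : C :=
  if u && v then Complex (- invsqrt2) 0 else Complex invsqrt2 0.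

Definition omega8 : C := Complex invsqrt2 invsqrt2.

Definition apply_gate (N : nat) (g : gate) (st : bits N -> C) : bits N -> C :=
  match g with
  | GH i => fun b => \sum_(v : bool) Hent (bitn b i) v * st (setb b i v)
  | GT i => fun b => (if bitn b i then omega8 else 1) * st b
  | GCNOT a t => fun b => st (setb b t (bitn b t (+) bitn b a))
  end.

Definition run (c : circ) (st : bits (nqubits c) -> C) : bits (nqubits c) -> C :=
  foldl (fun s g => apply_gate g s) st (cgates c).

Definition accept_prob (c : circ) (st : bits (nqubits c) -> C) : R :=
  \sum_(b : bits (nqubits c) | bitn b 0) sqn (run st b).

Definition is_proof (m : nat) (phi : bits m -> C) : Prop :=
  \sum_(b : bits m) sqn (phi b) = 1.

Definition block (c : circ) (b : bits (nqubits c)) (j : nat) : bits (cqM c) :=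
  [ffun t : 'I_(cqM c) => bitn b (cqV c + j * cqM c + t)].

(* |0...0> (work register) tensor |phi_0> tensor ... tensor |phi_(k-1)> *)
Definition init_state (c : circ) (phis : nat -> bits (cqM c) -> C)
  : bits (nqubits c) -> C :=
  fun b => if [forall i : 'I_(cqV c), ~~ bitn b i]
           then \prod_(j < ck c) phis j (block b j) else 0.

Definition zero_state (N : nat) : bits N -> C :=
  fun b => if [forall i : 'I_N, ~~ b i] then 1 else 0.

Definition poly_uniform (V : seq bool -> circ) : Prop :=
  exists f, PolyTime f /\ forall x, decode (f x) = Some (V x).

Definition is_verifier (k : nat -> nat) (V : seq bool -> circ) : Prop :=
  [/\ poly_uniform V,
      exists qv qm : nat -> nat, forall x,
        cqV (V x) = qv (size x) /\ cqM (V x) = qm (size x)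
    & forall x, ck (V x) = k (size x)].

Definition QMA (k : nat -> nat) (c s : nat -> R) (A : problem) : Prop :=
  exists V, is_verifier k V /\
    (forall x, yes A x -> exists phis : nat -> bits (cqM (V x)) -> C,
        (forall j, (j < k (size x))%N -> is_proof (phis j)) /\
        c (size x) <= @accept_prob (V x) (@init_state (V x) phis)) /\
    (forall x, no A x -> forall phis : nat -> bits (cqM (V x)) -> C,
        (forall j, (j < k (size x))%N -> is_proof (phis j)) ->
        @accept_prob (V x) (@init_state (V x) phis) <= s (size x)).

Definition EQMA (k : nat -> nat) (A : problem) : Prop :=
  QMA k (fun _ => 1) (fun _ => 0) A.

Definition RQMA (k : nat -> nat) (A : problem) : Prop :=
  QMA k (fun _ => 2^-1) (fun _ => 0) A.

Definition NQMA (k : nat -> nat) (A : problem) : Prop :=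
  exists c : nat -> R, (forall n, 0 < c n <= 1) /\ QMA k c (fun _ => 0) A.

Definition NQP (A : problem) : Prop :=
  exists Q : seq bool -> circ, poly_uniform Q /\
    (forall x, yes A x -> 0 < @accept_prob (Q x) (@zero_state (nqubits (Q x)))) /\
    (forall x, no A x -> @accept_prob (Q x) (@zero_state (nqubits (Q x))) = 0).

End Semantics.

(* Main.v *)
(** Quantum side.  A one-proof verifier on [qv + qm] qubits accepts some proof
    with positive probability iff, by linearity, it so accepts some basis
    string.  Feeding it one half of [qm] EPR pairs amounts to a uniformly random
    basis string, so the circuit that prepares the pairs and then runs the
    verifier decides the problem in the NQP sense.  Conversely an NQP circuit
    is a verifier with a proof of zero qubits, once its register is padded to
    a size [P n] depending only on the input length.  The threshold [c n] is the
    least positive acceptance probability over the inputs of length [n].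

    Turing machine side.  Both transformations are programmed on machines with
    a fixed number of stacks of bits.  Such a machine is run by a Turing machine
    whose tape holds the stacks in order, each followed by one blank: the
    initial tape [x] is then already the encoding of [x] in the first stack and
    empty stacks elsewhere, and the output is the first stack.  Pushing and
    popping shift the rest of the tape by one cell, so a run is slowed down only
    by a factor linear in the length of the tape.  In the other direction the
    two halves of the tape of a Turing machine are two stacks, with two bits
    per cell. *)

Require Import Defs.
From HB Require Import structures.
From mathcomp Require Import all_boot all_order all_algebra.
From mathcomp Require Import boolp reals complex zify.
Set Implicit Arguments. Unset Strict Implicit. Unset Printing Implicit Defensive.

(** * Bounded reachability under an iterated map *)

Section Reach.
Variables (T : Type) (f : T -> T).

Definition reach (n : nat) (c c' : T) : Prop :=
  exists2 n', (n' <= n)%N & iter n' f c = c'.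

Lemma reach_refl n c : reach n c c.
Proof. by exists 0. Qed.

Lemma reach_trans n1 n2 c1 c2 c3 :
  reach n1 c1 c2 -> reach n2 c2 c3 -> reach (n1 + n2) c1 c3.
Proof.
move=> [m1 le1 <-] [m2 le2 <-]; exists (m2 + m1); last by rewrite iterD.
by rewrite addnC leq_add.
Qed.

Lemma reach_step n c c' : reach n (f c) c' -> reach n.+1 c c'.
Proof. by move=> [m le <-]; exists m.+1 => //; rewrite iterSr. Qed.

Lemma reach_le n n' c c' : (n <= n')%N -> reach n c c' -> reach n' c c'.
Proof. by move=> le [m lem <-]; exists m => //; apply: leq_trans le. Qed.

End Reach.

(** * Stack machines *)

Section Mach.
Variable k : nat.

Inductive instr (X : Type) : Type :=
| Push of 'I_k & bool & X
| Pop of 'I_k & (option bool -> X)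
| Nop of X.

Definition map_instr (X Y : Type) (h : X -> Y) (i : instr X) : instr Y :=
  match i with
  | Push j b x => Push j b (h x)
  | Pop j f => Pop j (h \o f)
  | Nop x => Nop (h x)
  end.

(** An exit in [E] carries a returned value, so that machines compose monadically. The start may
    itself be an exit, which lets [ret] take no step at all. *)
Record mach (E : Type) := Mach {
  mS : finType;
  mstart : mS + E;
  mcode : mS -> instr (mS + E) }.

Definition stacks := seq (seq bool).

Definition exec (X : Type) (i : instr X) (st : stacks) : X * stacks :=
  match i with
  | Push j b x => (x, set_nth [::] st j (b :: nth [::] st j))
  | Pop j f => if nth [::] st j is b :: s then (f (Some b), set_nth [::] st j s)
               else (f None, st)
  | Nop x => (x, st)
  end.

Lemma exec_map (X Y : Type) (h : X -> Y) (i : instr X) (st : stacks) :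
  exec (map_instr h i) st = (h (exec i st).1, (exec i st).2).
Proof. by case: i => [j b x|j f|x] //=; case: nth. Qed.

Definition mstep E (m : mach E) (c : (mS m + E) * stacks) :=
  match c.1 with
  | inl s => exec (mcode s) c.2
  | inr e => c
  end.

(* [n] is only an upper bound on the number of steps. *)
Definition runs E (m : mach E) st e st' n :=
  reach (mstep (m := m)) n (mstart m, st) (inr e, st').

Lemma runs_le E (m : mach E) st e st' n n' :
  (n <= n')%N -> runs m st e st' n -> runs m st e st' n'.
Proof. exact: reach_le. Qed.

(** Step-for-step simulation. Since [h] may send an exit of [m] to a running state of [m'], it
    covers the embedding of a component into [bind] or [loop], where control continues after the
    exit. *)
Lemma reach_sim E E' (m : mach E) (m' : mach E') (h : mS m + E -> mS m' + E') :
  (forall s, exists s', h (inl s) = inl s' /\ mcode s' = map_instr h (mcode s)) ->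
  forall n c st e st', reach (mstep (m := m)) n (c, st) (inr e, st') ->
  reach (mstep (m := m')) n (h c, st) (h (inr e), st').
Proof.
move=> hh n c st e st' [n' le]; move: c st le; elim: n' n => [|n' IH] n c st le.
  by case=> -> ->; apply: reach_refl.
(* An exit is a fixed point of [mstep], so the idle steps of [m] are dropped; this is why only a
   bound on the time is transported. *)
case: n le => // n le; case: c => [s|e0]; rewrite iterSr; last first.
  by move/(IH n _ _ le); apply: reach_le.
have [s' [-> es']] := hh s.
rewrite {2}/mstep /= => H; apply: reach_step; rewrite {2}/mstep /= es' exec_map.
by apply: IH => //; rewrite -H; case: exec.
Qed.

Definition ret E (e : E) : mach E := @Mach E void (inr e) (fun s => match s with end).

Definition push (j : 'I_k) (b : bool) : mach unit :=
  @Mach unit unit (inl tt) (fun _ => Push j b (inr tt)).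

Definition pop (j : 'I_k) : mach (option bool) :=
  @Mach _ unit (inl tt) (fun _ => Pop j inr).

Lemma runs_ret E (e : E) st : runs (ret e) st e st 0.
Proof. exact: reach_refl. Qed.

Lemma runs_push j b st :
  runs (push j b) st tt (set_nth [::] st j (b :: nth [::] st j)) 1.
Proof. by exists 1. Qed.

Lemma runs_pop j st :
  runs (pop j) st (ohead (nth [::] st j))
    (if nth [::] st j is _ :: s then set_nth [::] st j s else st) 1.
Proof. by exists 1 => //=; rewrite /mstep /=; case: nth. Qed.

Section Bind.
Variables (E : finType) (E' : Type) (m : mach E) (f : E -> mach E').

(** The returned value is remembered in the control state, which stays finite because [E] is
    finite. *)
Let S : finType := (mS m + {e : E & mS (f e)})%type.

Definition bind_inr (e : E) (c : mS (f e) + E') : S + E' :=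
  match c with
  | inl s => inl (inr (Tagged (fun e => mS (f e)) s))
  | inr e' => inr e'
  end.

Definition bind_inl (c : mS m + E) : S + E' :=
  match c with
  | inl s => inl (inl s)
  | inr e => bind_inr (mstart (f e))
  end.

Definition bind : mach E' :=
  @Mach E' S (bind_inl (mstart m))
    (fun s => match s with
              | inl s => map_instr bind_inl (mcode s)
              | inr u => map_instr (@bind_inr (tag u)) (mcode (tagged u))
              end).

Lemma runs_bind st e st1 e' st2 n1 n2 :
  runs m st e st1 n1 -> runs (f e) st1 e' st2 n2 ->
  runs bind st e' st2 (n1 + n2).
Proof.
move=> H1 H2; apply: (@reach_trans _ _ _ _ _ (bind_inl (inr e), st1)).
  by apply: (@reach_sim _ _ m bind bind_inl) H1 => s; exists (inl s).
apply: (@reach_sim _ _ (f e) bind (@bind_inr e)) H2 => s.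
by exists (inr (Tagged (fun e => mS (f e)) s)).
Qed.
End Bind.

Section Loop.
Variables (I : finType) (E : Type) (body : I -> mach (I + E)).

Let S : finType := (I + {i : I & mS (body i)})%type.

Definition loop_in (i : I) (c : mS (body i) + (I + E)) : S + E :=
  match c with
  | inl s => inl (inr (Tagged (fun i => mS (body i)) s))
  | inr (inl i') => inl (inl i')
  | inr (inr e) => inr e
  end.

(** Each round begins with a [Nop] in a state of its own. Jumping straight to the start of the next
    body could run in circles when bodies exit without a step. *)
Definition loop (i : I) : mach E :=
  @Mach E S (inl (inl i))
    (fun s => match s with
              | inl i => Nop (loop_in (mstart (body i)))
              | inr u => map_instr (@loop_in (tag u)) (mcode (tagged u))
              end).

Lemma runs_loop_body i r st st1 n :
  runs (body i) st r st1 n ->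
  reach (mstep (m := loop i)) n.+1 (mstart (loop i), st) (@loop_in i (inr r), st1).
Proof.
move=> H; apply: reach_step; rewrite {2}/mstep /=.
apply: (@reach_sim _ _ (body i) (loop i) (@loop_in i)) H => s.
by exists (inr (Tagged (fun e => mS (body e)) s)).
Qed.

Lemma runs_loop_exit i st e st1 n :
  runs (body i) st (inr e) st1 n -> runs (loop i) st e st1 n.+1.
Proof. exact: runs_loop_body. Qed.

Lemma runs_loop_next i i' st st1 e st2 n1 n2 :
  runs (body i) st (inl i') st1 n1 -> runs (loop i') st1 e st2 n2 ->
  runs (loop i) st e st2 (n1.+1 + n2).
Proof. by move=> /runs_loop_body H1 H2; apply: reach_trans H1 H2. Qed.
End Loop.

Definition seqm (E : Type) (m1 : mach unit) (m2 : mach E) : mach E :=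
  bind m1 (fun _ => m2).

Lemma runs_seqm E (m1 : mach unit) (m2 : mach E) st st1 e st2 n1 n2 :
  runs m1 st tt st1 n1 -> runs m2 st1 e st2 n2 ->
  runs (seqm m1 m2) st e st2 (n1 + n2).
Proof. exact: runs_bind. Qed.

Definition whilepop (j : 'I_k) (f : bool -> mach unit) : mach unit :=
  loop (fun _ : unit =>
    bind (pop j) (fun o => if o is Some b then seqm (f b) (ret (inl tt))
                           else ret (inr tt))) tt.

Lemma runs_whilepop_nil (j : 'I_k) f st :
  nth [::] st j = [::] -> runs (whilepop j f) st tt st 2.
Proof.
move=> e; apply: (@runs_loop_exit _ _ _ tt _ _ _ 1).
have H := runs_pop j st; rewrite e in H.
by apply: runs_bind H _; apply: runs_ret.
Qed.

Lemma runs_whilepop_cons (j : 'I_k) f st b s st1 st2 n1 n2 :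
  nth [::] st j = b :: s ->
  runs (f b) (set_nth [::] st j s) tt st1 n1 ->
  runs (whilepop j f) st1 tt st2 n2 ->
  runs (whilepop j f) st tt st2 (n1.+2 + n2).
Proof.
move=> e H1; apply: (@runs_loop_next _ _ _ tt tt).
have H := runs_pop j st; rewrite e in H; rewrite -add1n.
by apply: runs_bind H _; rewrite /= -[n1]addn0; apply: runs_seqm H1 (runs_ret _ _).
Qed.

End Mach.

(** * Compiling stack machines to Turing machines *)

(* At home the head is on the first cell of the first stack.  [Walk] moves to the
   stack concerned; [Ins] carries cells one step to the right; [Go] moves to the
   last separator, from where [Del] carries cells one step to the left, ending
   with the popped bit in hand; [Ret] goes home.  Each phase knows where to stop
   by counting separators, so no cell beyond the encoding is ever relied on. *)
Inductive phase := Fetch | Walk | Ins | Go | Del | Ret.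

(** Nested options are finite already, and this injection transports their finiteness to [phase]. *)
Definition phase_code (p : phase) : option (option (option (option bool))) :=
  match p with
  | Fetch => None | Walk => Some None | Ins => Some (Some None)
  | Go => Some (Some (Some None)) | Del => Some (Some (Some (Some true)))
  | Ret => Some (Some (Some (Some false)))
  end.

Definition phase_decode (o : option (option (option (option bool)))) : phase :=
  match o with
  | None => Fetch | Some None => Walk | Some (Some None) => Ins
  | Some (Some (Some None)) => Go | Some (Some (Some (Some true))) => Del
  | Some (Some (Some (Some false))) => Ret
  end.

Lemma phase_codeK : cancel phase_code phase_decode.
Proof. by case. Qed.

HB.instance Definition _ := Finite.copy phase (can_type phase_codeK).

Section Compile.
Variables (k : nat) (m : mach k unit).

Let X : finType := (mS m + unit)%type.
Let Q : finType := (X * phase * option bool * 'I_k.+1)%type.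

Definition pred_if_sep (h : option bool) (c : nat) : nat :=
  if h is None then c.-1 else c.

(** The state holds the stack machine state, the phase, the carried cell and the number of
    separators still to be met. The counter is a natural number here, so that the run lemmas need no
    bounded arithmetic; [pack] bounds it afterwards. *)
Definition qstep (q : X * phase * option bool * nat) (h : option bool) :
    (X * phase * option bool * nat) * option bool * move :=
  let: (x, ph, cr, c) := q in
  match ph, x with
  | Ret, _ =>
    if h is None then
      if c is 0 then ((x, Fetch, None, 0), h, MoveR)
      else ((x, Ret, None, c.-1), h, MoveL)
    else ((x, Ret, None, c), h, MoveL)
  | _, inr _ => (q, h, MoveS)
  | _, inl s =>
    match ph, mcode s with
    | Fetch, Nop x' => ((x', Fetch, None, 0), h, MoveS)
    | Fetch, Push j _ _ => ((x, Walk, None, nat_of_ord j), h, MoveS)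
    | Fetch, Pop j _ => ((x, Walk, None, nat_of_ord j), h, MoveS)
    | Walk, i =>
      if c is _.+1 then ((x, Walk, None, pred_if_sep h c), h, MoveR) else
      match i with
      | Push j b _ => ((x, Ins, Some b, k - j), h, MoveS)
      | Pop j f => if h is None then ((f None, Ret, None, nat_of_ord j), h, MoveL)
                   else ((x, Go, None, k - j), h, MoveS)
      | Nop _ => (q, h, MoveS)
      end
    | Ins, Push j b x' =>
      if c is 0 then ((x', Ret, None, k.-1), cr, MoveL)
      else ((x, Ins, h, pred_if_sep h c), cr, MoveR)
    | Go, Pop j f =>
      if (h == None) && (c == 1) then ((x, Del, None, k - j), h, MoveS)
      else ((x, Go, None, pred_if_sep h c), h, MoveR)
    | Del, Pop j f =>
      if (h == None) && (c == 0) then ((f cr, Ret, None, nat_of_ord j), h, MoveS)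
      else ((x, Del, h, pred_if_sep h c), cr, MoveL)
    | _, _ => (q, h, MoveS)
    end
  end.

Definition halt_st : X * phase * option bool * nat := (inr tt, Fetch, None, 0).

Definition pack (q : X * phase * option bool * nat) : Q :=
  let: (x, ph, cr, c) := q in (x, ph, cr, inord c).

Definition unpack (q : Q) : X * phase * option bool * nat :=
  let: (x, ph, cr, c) := q in (x, ph, cr, nat_of_ord c).

Lemma packK q : q.2 <= k -> unpack (pack q) = q.
Proof. by case: q => [[[x ph] cr] c] /= le; rewrite inordK. Qed.

Definition rank (q : Q) : 'I_(#|Q|.-1).+1 := inord (enum_rank q).
Definition unrank (i : 'I_(#|Q|.-1).+1) : Q := nth (pack halt_st) (enum Q) i.

Lemma rankK : cancel rank unrank.
Proof.
move=> q; rewrite /rank /unrank inordK ?nth_enum_rank //.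
by rewrite prednK //; apply/card_gt0P; exists q.
Qed.

Definition compiled : TM :=
  @TMk #|Q|.-1 (rank (pack (mstart m, Fetch, None, 0))) (rank (pack halt_st))
    (fun q h => let: (q', w, mv) := qstep (unpack (unrank q)) h in
                (rank (pack q'), w, mv)).

(* [r] starts with the scanned cell. *)
Definition cfg (q : X * phase * option bool * nat) (l r : seq (option bool))
  : config compiled := @Config compiled (rank (pack q)) l (head None r) (behead r).

(* The scanned cell is the first one of [lw], counting towards the left. *)
Definition lcfg q lw r := cfg q (behead lw) (head None lw :: r).

Lemma step_cfg q l r : q.2 <= k -> q <> halt_st ->
  tm_step (cfg q l r) =
  (let: (q', w, mv) := qstep q (head None r) in
   match mv with
   | MoveS => cfg q' l (w :: behead r)
   | MoveL => lcfg q' l (w :: behead r)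
   | MoveR => cfg q' (w :: l) (behead r)
   end).
Proof.
move=> le nh; rewrite /tm_step /=; case: eqP => [e|_].
  have := congr1 (fun i => unpack (unrank i)) e.
  by rewrite !rankK packK // => e1; case: nh; rewrite e1 /= inordK.
rewrite rankK packK //; case: qstep => [[q' w] []] //=; first by case: l.
by rewrite /cfg; case: r => [|h [|h' r]].
Qed.

Notation reachT := (reach (tm_step (M := compiled))).
Notation seps u := (count_mem None u).

(** Shows that the counter stays positive, and the phase goes on, as long as the final separator has
    not been passed. *)
Lemma sep_cons (a : option bool) u : last a u = None ->
  last None u = None /\ 0 < (a == None) + seps u.
Proof.
move=> la; split; first by case: u la.
case: a la => // b la; rewrite add0n -has_count; apply/hasP.
by case: u la => //= a u <-; exists (last a u); rewrite ?mem_last.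
Qed.

Lemma pred_if_sepE a c : pred_if_sep a ((a == None) + c) = c.
Proof. by case: a. Qed.

(** As [u] is empty or ends in a separator, the counter reaches zero exactly when all of [u] has
    been crossed. *)
Lemma walk_run s u l r : seps u <= k -> last None u = None ->
  reachT (size u) (cfg (inl s, Walk, None, seps u) l (u ++ r))
                  (cfg (inl s, Walk, None, 0) (catrev u l) r).
Proof.
elim: u l => [|a u IH] l /= le la; first exact: reach_refl.
have [lu pos] := sep_cons la.
apply: reach_step; rewrite step_cfg //.
have -> : qstep (inl s, Walk, None, (a == None) + seps u) a =
          ((inl s, Walk, None, seps u), a, MoveR).
  by rewrite -[in RHS](pred_if_sepE a (seps u)) /=; case: (_ + _) pos.
by apply: IH => //; case: (a == None) le => /=; lia.
Qed.

(** The word [cr :: u] is laid over [u], and its last cell remains in hand. *)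
Lemma ins_run s j b x cr u l r : mcode s = Push j b x ->
  seps u <= k -> last None u = None ->
  reachT (size u) (cfg (inl s, Ins, cr, seps u) l (u ++ r))
    (cfg (inl s, Ins, last cr u, 0) (catrev (belast cr u) l) r).
Proof.
move=> es; elim: u cr l => [|a u IH] cr l /= le la; first exact: reach_refl.
have [lu pos] := sep_cons la.
apply: reach_step; rewrite step_cfg //.
have -> : qstep (inl s, Ins, cr, (a == None) + seps u) a =
          ((inl s, Ins, a, seps u), cr, MoveR).
  by rewrite -[in RHS](pred_if_sepE a (seps u)) /= es; case: (_ + _) pos.
by apply: IH => //; case: (a == None) le => /=; lia.
Qed.

(** The counter is one ahead of [seps u] because this phase has to stop on the last separator and
    not behind it. *)
Lemma go_run s j f u l r : mcode s = Pop j f -> seps u < k ->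
  reachT (size u) (cfg (inl s, Go, None, (seps u).+1) l (u ++ r))
    (cfg (inl s, Go, None, 1) (catrev u l) r).
Proof.
move=> es; elim: u l => [|a u IH] l /= le; first exact: reach_refl.
apply: reach_step; rewrite step_cfg //.
have -> : qstep (inl s, Go, None, ((a == None) + seps u).+1) a =
          ((inl s, Go, None, (seps u).+1), a, MoveR).
  by rewrite /= es; case: a {le} => [b'|] /=.
by apply: IH => //; case: (a == None) le => /=; lia.
Qed.

(** The mirror image of [ins_run], with [w] read towards the left: every cell receives its right
    neighbour. *)
Lemma del_run s j f cr w l r : mcode s = Pop j f -> seps w <= k ->
  reachT (size w) (lcfg (inl s, Del, cr, seps w) (w ++ l) r)
    (lcfg (inl s, Del, last cr w, 0) l (catrev (belast cr w) r)).
Proof.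
move=> es; elim: w cr r => [|a w IH] cr r /= le; first exact: reach_refl.
apply: reach_step; rewrite step_cfg //.
have -> : qstep (inl s, Del, cr, (a == None) + seps w) a =
          ((inl s, Del, a, seps w), cr, MoveL).
  by rewrite /= es; case: a {le} => [b'|] /=.
by apply: IH => //; case: (a == None) le => /=; lia.
Qed.

(** The blank to the left of the first stack acts as end marker: it is the first blank met once the
    counter is exhausted. *)
Lemma ret_run x w l r : seps w <= k -> head None l = None ->
  reachT (size w).+1 (lcfg (x, Ret, None, seps w) (w ++ l) r)
    (cfg (x, Fetch, None, 0) (None :: behead l) (catrev w r)).
Proof.
move=> + hl; elim: w r => [|a w IH] r /= le.
  by apply: reach_step; rewrite step_cfg //= hl; apply: reach_refl.
apply: reach_step; rewrite step_cfg //.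
have -> : qstep (x, Ret, None, (a == None) + seps w) a =
          ((x, Ret, None, seps w), a, MoveL).
  by case: (x) => [s|e] /=; case: (a).
by apply: IH => //; case: (a == None) le => /=; lia.
Qed.

Definition tape (st : stacks) : seq (option bool) :=
  flatten [seq rcons (map Some s) None | s <- st].

Lemma seps_tape st : seps (tape st) = size st.
Proof.
elim: st => //= s st IH; rewrite /tape /= count_cat IH -/(tape _) -cats1 count_cat /=.
by rewrite count_map /= (@eq_count _ _ pred0) ?count_pred0.
Qed.

Lemma last_tape st : last None (tape st) = None.
Proof.
elim/last_ind: st => //= st s IH.
by rewrite /tape map_rcons flatten_rcons last_cat last_rcons.
Qed.

Lemma size_tape st : size (tape st) = \sum_(s <- st) (size s).+1.
Proof.
elim: st => [|s st IH]; first by rewrite big_nil.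
by rewrite big_cons /tape /= size_cat size_rcons size_map -IH.
Qed.

Lemma stacks_split (st : stacks) (j : 'I_k) : size st = k ->
  exists pre post, [/\ size pre = j, size post = (k - j).-1,
    st = pre ++ nth [::] st j :: post &
    forall s, set_nth [::] st j s = pre ++ s :: post].
Proof.
move=> sz; exists (take j st), (drop j.+1 st).
have lj : j < size st by rewrite sz.
rewrite size_take size_drop sz ltn_ord -drop_nth // cat_take_drop; split=> //; first by lia.
by move=> s; rewrite set_nthE lj.
Qed.

Lemma tape_cons st0 s post :
  tape (st0 ++ s :: post) = tape st0 ++ map Some s ++ None :: tape post.
Proof. by rewrite /tape map_cat flatten_cat /= cat_rcons. Qed.

Lemma catrev_rev T (u r : seq T) : catrev (rev u) r = u ++ r.
Proof. by rewrite catrevE revK. Qed.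

Lemma home_run x v l r : seps v <= k -> head None l = None ->
  reachT (size v).+1 (lcfg (x, Ret, None, seps v) (catrev v l) r)
    (cfg (x, Fetch, None, 0) (None :: behead l) (v ++ r)).
Proof.
have := @ret_run x (rev v) l r.
by rewrite count_rev size_rev -catrevE catrev_rev.
Qed.

(** The tape beyond the encoding changes: a push overwrites its first cell and a pop leaves a blank
    in front of it, hence the existential [r']. The blank at the left end is an invariant. *)
Lemma op_run s st l r : size st = k -> head None l = None ->
  exists l' r', head None l' = None /\ reachT (4 * size (tape st) + 10)
    (cfg (inl s, Fetch, None, 0) l (tape st ++ r))
    (cfg ((exec (mcode s) st).1, Fetch, None, 0) l'
         (tape (exec (mcode s) st).2 ++ r')).
Proof.
move=> sz hl; case es: (mcode s) => [j b x|j f|x].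
- have [pre [post [spre spost est setE]]] := stacks_split j sz.
  set s0 := nth [::] st j in est.
  have jk := ltn_ord j.
  set u := map Some s0 ++ None :: tape post.
  have lu cr : last cr u = None.
    by rewrite last_cat /=; have := last_tape post; case: (tape post).
  have su : seps u = k - j.
    rewrite count_cat /= seps_tape spost count_map (@eq_count _ _ pred0) //.
    by rewrite count_pred0; lia.
  rewrite /= -/s0 setE.
  have tst : tape st = tape pre ++ u by rewrite [in LHS]est tape_cons.
  have tst' : tape (pre ++ (b :: s0) :: post) = tape pre ++ Some b :: u.
    by rewrite tape_cons.
  exists (None :: behead l), (behead r); split=> //.
  have st1 : reachT (size (tape pre)).+1 (cfg (inl s, Fetch, None, 0) l (tape st ++ r))
      (cfg (inl s, Walk, None, 0) (catrev (tape pre) l) (u ++ r)).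
    apply: reach_step; rewrite step_cfg //= es tst -!catA -spre -(seps_tape pre).
    by apply: walk_run; rewrite ?last_tape // seps_tape; lia.
  have st2 : reachT (size u).+1
      (cfg (inl s, Walk, None, 0) (catrev (tape pre) l) (u ++ r))
      (cfg (inl s, Ins, None, 0)
         (catrev (belast (Some b) u) (catrev (tape pre) l)) r).
    apply: reach_step; rewrite step_cfg //= es -{2}(lu (Some b)) -su.
    by apply: ins_run es _ (lu _); rewrite su; lia.
  (* These are the cells to the left of the final separator, which is written last; the return
     therefore crosses [k.-1] separators. *)
  set v := tape pre ++ belast (Some b) u.
  have sv : seps v = k.-1.
    have := congr1 (count_mem None) (lastI (Some b) u).
    rewrite lu -cats1 count_cat /= su addn1 => e.
    by rewrite count_cat seps_tape; lia.
  have st3 : reachT (size v).+2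
      (cfg (inl s, Ins, None, 0)
         (catrev (belast (Some b) u) (catrev (tape pre) l)) r)
      (cfg (x, Fetch, None, 0) (None :: behead l)
         (tape (pre ++ (b :: s0) :: post) ++ behead r)).
    apply: reach_step; rewrite step_cfg //= es.
    have -> : tape (pre ++ (b :: s0) :: post) ++ behead r = v ++ None :: behead r.
      by rewrite tst' (lastI (Some b) u) lu -cats1 /v -!catA.
    rewrite -catrev_catl -/v -sv.
    by apply: home_run => //; rewrite sv; lia.
  apply: reach_le (reach_trans st1 (reach_trans st2 st3)).
  by rewrite /v tst !(size_cat (tape pre)) size_belast; lia.
- have [pre [post [spre spost est setE]]] := stacks_split j sz.
  rewrite /=; move: est setE; case: (nth [::] st j) => [|b s0] est setE /=.
    have jk := ltn_ord j.
    have tst : tape st = tape pre ++ None :: tape post by rewrite [in LHS]est tape_cons.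
    exists (None :: behead l), r; split=> //.
    apply: (@reach_le _ _ ((size (tape pre)).+1 + (size (tape pre)).+2)).
      rewrite tst size_cat; lia.
    apply: reach_step; rewrite step_cfg //= es tst -!catA -spre -(seps_tape pre).
    apply: (reach_trans (c2 := cfg (inl s, Walk, None, 0) (catrev (tape pre) l)
                                 (None :: tape post ++ r))).
      by apply: walk_run; rewrite ?last_tape // seps_tape; lia.
    apply: reach_step; rewrite step_cfg //= es -spre -(seps_tape pre).
    by apply: home_run => //; rewrite seps_tape; lia.
  have jk := ltn_ord j.
  rewrite setE; exists (None :: behead l), (None :: r); split=> //.
  set u := map Some s0 ++ None :: tape post.
  have lu cr : last cr u = None.
    by rewrite last_cat /=; have := last_tape post; case: (tape post).
  have su : seps u = k - j.
    rewrite count_cat /= seps_tape spost count_map (@eq_count _ _ pred0) //.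
    by rewrite count_pred0; lia.
  (* The last separator is split off, since deletion starts from it. *)
  have [u' uE] : exists u', Some b :: u = rcons u' None.
    by exists (belast (Some b) u); rewrite [LHS]lastI lu.
  have su' : (seps u').+1 = k - j.
    by rewrite -su -[RHS]/(seps (Some b :: u)) uE -cats1 count_cat addn1.
  have szu : size u' = size u by have := congr1 size uE; rewrite size_rcons => -[].
  have tst : tape st = tape pre ++ rcons u' None by rewrite [in LHS]est tape_cons -uE.
  have st1 : reachT (size (tape pre)).+2 (cfg (inl s, Fetch, None, 0) l (tape st ++ r))
      (cfg (inl s, Go, None, k - j) (catrev (tape pre) l) (rcons u' None ++ r)).
    apply: reach_step; rewrite step_cfg //= es -spre -(seps_tape pre) -/(cfg _ _ _).
    rewrite -addn1; apply: (reach_trans (c2 := cfg (inl s, Walk, None, 0)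
                         (catrev (tape pre) l) (rcons u' None ++ r))).
      by rewrite tst -catA; apply: walk_run; rewrite ?last_tape // seps_tape; lia.
    rewrite seps_tape spre -uE; apply: reach_step; rewrite step_cfg //= es; exact: reach_refl.
  have st2 : reachT (size u').+1
      (cfg (inl s, Go, None, k - j) (catrev (tape pre) l) (rcons u' None ++ r))
      (lcfg (inl s, Del, None, k - j) (catrev (rcons u' None) (catrev (tape pre) l)) r).
    rewrite -addn1; apply: (reach_trans (c2 := cfg (inl s, Go, None, 1)
                      (catrev u' (catrev (tape pre) l)) (None :: r))).
      by rewrite -su' cat_rcons; apply: go_run es _; lia.
    apply: reach_step; rewrite step_cfg //=; last by lia.
    by rewrite es /= -cats1 catrev_catl; apply: reach_refl.
  (* The cell just before stack [j] is blank in any case: it is the separator of the preceding stack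
     or the left end marker. There the deletion stops. *)
  have hl1 : head None (catrev (tape pre) l) = None.
    rewrite catrevE -[tape pre]revK; have := last_tape pre.
    by case/lastP: (tape pre) => [|t a] //; rewrite last_rcons revK rev_rcons => ->.
  have st3 : reachT (size u').+1
      (lcfg (inl s, Del, None, k - j) (catrev (rcons u' None) (catrev (tape pre) l)) r)
      (lcfg (inl s, Del, Some b, 0) (catrev (tape pre) l) (u ++ None :: r)).
    have := @del_run s j f None (rev (Some b :: u)) (catrev (tape pre) l) r es.
    rewrite count_rev size_rev /= su -szu -catrevE.
    by rewrite -uE rev_cons last_rcons belast_rcons /= catrev_rev add0n; apply; lia.
  have st4 : reachT (size (tape pre)).+2
      (lcfg (inl s, Del, Some b, 0) (catrev (tape pre) l) (u ++ None :: r))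
      (cfg (f (Some b), Fetch, None, 0) (None :: behead l)
         (tape (pre ++ s0 :: post) ++ None :: r)).
    apply: reach_step; rewrite step_cfg //= hl1 es /= tape_cons -/u -catA.
    have := @home_run (f (Some b)) (tape pre) l (u ++ None :: r).
    by rewrite seps_tape spre /lcfg hl1; apply => //; lia.
  apply: reach_le (reach_trans st1 (reach_trans st2 (reach_trans st3 st4))).
  rewrite tst !(size_cat (tape pre)) size_rcons; lia.
- exists l, r; split=> //; apply: (@reach_le _ _ 1); first by lia.
  by apply: reach_step; rewrite step_cfg //= es; apply: reach_refl.
Qed.

Lemma size_exec Y (i : instr k Y) st : size st = k -> size (exec i st).2 = k.
Proof.
move=> sz; case: i => [j b x|j f|x] //=; last case: nth => //= _ t.
all: by rewrite size_set_nth sz; apply/maxn_idPr.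
Qed.

Lemma size_tape_exec Y (i : instr k Y) st : size st = k ->
  size (tape (exec i st).2) <= (size (tape st)).+1.
Proof.
move=> sz; case: i => [j b x|j f|x] //=.
- have [pre [post [_ _ est ->]]] := stacks_split j sz.
  by rewrite [in X in _ <= X]est !tape_cons !size_cat /= !size_map; lia.
- have [pre [post [_ _ est setE]]] := stacks_split j sz.
  case: (nth _ _ _) est => //= b t est.
  by rewrite setE [in X in _ <= X]est !tape_cons !size_cat /= !size_map; lia.
Qed.

(** A step costs time linear in the tape, and the tape grows by at most one cell per step, so
    [size (tape st) + n] bounds its length throughout. *)
Lemma mrun_compiled n c st st' l r :
  size st = k -> head None l = None ->
  iter n (mstep (m := m)) (c, st) = (inr tt, st') ->
  exists l' r', reachT (n * (4 * (size (tape st) + n) + 10))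
    (cfg (c, Fetch, None, 0) l (tape st ++ r))
    (cfg halt_st l' (tape st' ++ r')).
Proof.
elim: n c st l r => [|n IH] c st l r sz hl.
  by case=> -> <-; exists l, r; apply: reach_refl.
rewrite iterSr; case: c => [s|e].
  rewrite {2}/mstep /= => H; have [l1 [r1 [hl1 H1]]] := op_run s r sz hl.
  have := IH (exec (mcode s) st).1 _ l1 r1 (size_exec (mcode s) sz) hl1.
  have le := size_tape_exec (mcode s) sz.
  rewrite -surjective_pairing => /(_ H) [l' [r' H2]].
  exists l', r'; apply: reach_le (reach_trans H1 H2).
  by rewrite mulSn leq_add //; [lia | apply: leq_mul => //; lia].
move=> /(IH _ _ l r sz hl) [l' [r' H]]; exists l', r'; apply: reach_le H.
by apply: leq_mul => //; lia.
Qed.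

End Compile.

(* The initial tape lacks the explicit trailing blanks of [tape]. *)
Definition pad (M : TM) (i : nat) (c : config M) : config M :=
  @Config M (cf_state c) (cf_left c) (cf_head c) (cf_right c ++ nseq i None).

Lemma step_pad M i (c : config M) : exists i', tm_step (pad i c) = pad i' (tm_step c).
Proof.
rewrite /tm_step /pad /=; case: eqP => _; first by exists i.
case: c => q l h r /=; case: tm_delta => [[q' w] []]; first 1 last.
- by case: r => [|h' r]; [exists i.-1; case: i|exists i].
- by exists i.
- by exists i; case: l.
Qed.

Lemma iter_pad M n i (c : config M) :
  exists i', iter n (tm_step (M := M)) (pad i c) = pad i' (iter n (tm_step (M := M)) c).
Proof.
elim: n i c => [|n IH] i c; first by exists i.
by have [i' e] := step_pad i c; rewrite !iterSr e; apply: IH.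
Qed.

Lemma tm_output_pad M i (c : config M) : tm_output (pad i c) = tm_output c.
Proof.
rewrite /tm_output /=; case: cf_head => //= b; congr cons.
by elim: cf_right => [|[b'|] r IH] //=; [case: i | rewrite IH].
Qed.

Lemma nonblank_prefix_cat s r :
  nonblank_prefix (map Some s ++ None :: r) = s.
Proof. by elim: s => //= b s ->. Qed.

(** * Polynomial bounds *)

Definition polyb (p : nat -> nat) := exists c e, forall n, p n <= c * n.+1 ^ e.

Lemma polyb_const c : polyb (fun _ => c).
Proof. by exists c, 0 => n; rewrite muln1. Qed.

Lemma polyb_id : polyb id.
Proof. by exists 1, 1 => n; rewrite mul1n. Qed.

Lemma polyb_add p q : polyb p -> polyb q -> polyb (fun n => p n + q n).
Proof.
move=> [c [e H]] [c' [e' H']]; exists (c + c'), (e + e') => n.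
rewrite mulnDl leq_add //; [apply: leq_trans (H n) _|apply: leq_trans (H' n) _].
  by rewrite leq_mul // leq_pexp2l // leq_addr.
by rewrite leq_mul // leq_pexp2l // leq_addl.
Qed.

Lemma polyb_mul p q : polyb p -> polyb q -> polyb (fun n => p n * q n).
Proof.
move=> [c [e H]] [c' [e' H']]; exists (c * c'), (e + e') => n.
by rewrite expnD mulnACA leq_mul.
Qed.

Lemma polyb_affine a d : polyb (fun n => a * n ^ d + a).
Proof.
exists (a + a), d => n; rewrite mulnDl leq_add //.
  by rewrite leq_mul //; case: d => // d; rewrite leq_exp2r.
by rewrite leq_pmulr // expn_gt0.
Qed.

(** For [n > 0] one has [n.+1 <= 2 * n], which costs a factor [2 ^ e]; the case [n = 0] is absorbed
    by the additive constant. *)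
Lemma polyb_affine_bound p :
  polyb p -> exists a d, forall n, p n <= a * n ^ d + a.
Proof.
move=> [c [e H]]; exists (c * 2 ^ e), e => n; apply: leq_trans (H n) _.
rewrite -[X in _ + X]muln1 -mulnDr -mulnA leq_mul //.
case: n {H} => [|n]; first by rewrite exp1n muln_gt0 expn_gt0 addn_gt0 orbT.
apply: leq_trans (_ : (2 * n.+1) ^ e <= _); last by rewrite expnMn leq_mul // leq_addr.
by case: e => // e; rewrite leq_exp2r //; lia.
Qed.

Lemma PolyTime_of_mach k (m : mach k.+1 unit) f p : polyb p ->
  (forall x, exists st, runs m (x :: nseq k [::]) tt (f x :: st) (p (size x))) ->
  PolyTime f.
Proof.
move=> pb H.
have : polyb (fun n => p n * (4 * (n + k.+1 + p n) + 10)).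
  by repeat (apply: polyb_mul || apply: polyb_add || apply: polyb_const || exact: polyb_id || exact: pb).
move=> /polyb_affine_bound [a [d le]]; exists (compiled m), a, d => x.
have [st [n' len' Hn]] := H x.
set st0 := x :: _ in Hn.
have sz : size st0 = k.+1 by rewrite /= size_nseq.
have [l' [r' [t le_t Ht]]] := mrun_compiled (l := [::]) [::] sz erefl Hn.
(* The encoding is [x] followed by [k.+1] blanks. For empty [x] one of them is the scanned cell, so
   only [k] are added to the right. *)
have init : exists i, cfg (mstart m, Fetch, None, 0) [::] (tape st0 ++ [::]) =
                      pad i (tm_init (compiled m) x).
  have tE : tape st0 ++ [::] = map Some x ++ nseq k.+1 None.
    rewrite cats0 /tape /= cat_rcons; congr (_ ++ _ :: _).
    by elim: (k) => //= k' ->.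
  rewrite tE; case: (x) => [|b s]; first by exists k.
  by exists k.+1.
case: init => i init; have [i' Hp] := iter_pad t i (tm_init (compiled m) x).
have szt : size (tape st0) <= size x + k.+1.
  rewrite /st0 /tape /= size_cat size_rcons size_map -/(tape (nseq k [::])) size_tape.
  by rewrite big_nseq iter_addn_0 mul1n; lia.
exists t; split.
  apply: leq_trans le_t _; apply: leq_trans (le (size x)).
  by rewrite leq_mul //; lia.
rewrite init Hp in Ht; split; first by have := congr1 (@cf_state _) Ht.
(* The output ends at the separator of the first stack. *)
rewrite -(tm_output_pad i') Ht /tm_output /= -[RHS](@nonblank_prefix_cat _ (tape st ++ r')).
rewrite /tape /= cat_rcons -catA.
by case: (f x).
Qed.

(** * Simulating Turing machines by stack machines *)

Notation "p ;; q" := (seqm p q) (at level 61, right associativity).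
Notation stk i := (@Ordinal 8 i isT).

Lemma runs_set k (m : mach k unit) st st' st'' n :
  st' = st'' -> runs m st tt st' n -> runs m st tt st'' n.
Proof. by move=> ->. Qed.

Section Sim.
Variable M : TM.

Definition cell_code (c : option bool) : seq bool := [:: isSome c; odflt false c].
Definition cells (l : seq (option bool)) : seq bool := flatten (map cell_code l).

Definition pushcell (j : 'I_8) (c : option bool) : mach 8 unit :=
  push j (odflt false c) ;; push j (isSome c).

(** An exhausted stack also reads as a blank, so the infinite blank parts of the tape are not
    stored. *)
Definition popcell (j : 'I_8) : mach 8 (option bool) :=
  bind (pop j) (fun o => if o is Some t then
    bind (pop j) (fun b => ret 8 (if t then b else None)) else ret 8 None).

Lemma runs_pushcell (j : 'I_8) c st : j < size st ->
  runs (pushcell j c) st tt (set_nth [::] st j (cell_code c ++ nth [::] st j)) 2.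
Proof.
move=> lj; have := runs_seqm (runs_push j (odflt false c) st) (runs_push j (isSome c) _).
by rewrite nth_set_nth /= eqxx set_set_nth eqxx.
Qed.

Lemma set_nth_id (j : nat) (st : seq (seq bool)) : j < size st ->
  set_nth [::] st j (nth [::] st j) = st.
Proof. by elim: st j => //= s st IH [|j] //= lj; rewrite IH. Qed.

Lemma runs_popcell (j : 'I_8) l st : j < size st -> nth [::] st j = cells l ->
  runs (popcell j) st (head None l) (set_nth [::] st j (cells (behead l))) 2.
Proof.
move=> lj; case: l => [|c l] e.
  have H := runs_pop j st; rewrite e in H.
  rewrite -[cells _]e set_nth_id //; apply: (runs_le (n := 1 + 0)) => //.
  by apply: runs_bind H _; apply: runs_ret.
have H := runs_pop j st; rewrite e in H; apply: (runs_bind (n1 := 1) (n2 := 1) H) => /=.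
set st1 := set_nth _ _ _ _.
have e1 : nth [::] st1 j = odflt false c :: cells l by rewrite nth_set_nth /= eqxx.
have H1 := runs_pop j st1; rewrite e1 in H1.
apply: (runs_bind (n1 := 1) (n2 := 0) H1) => /=.
by rewrite set_set_nth eqxx; case: (c) => [b|]; apply: runs_ret.
Qed.

Definition conf (q : 'I_(tm_ns M).+1) l r : config M :=
  @Config M q l (head None r) (behead r).

Definition sim_body (q : 'I_(tm_ns M).+1) : mach 8 ('I_(tm_ns M).+1 + unit) :=
  if q == tm_halt M then ret 8 (inr tt) else
  bind (popcell (stk 2)) (fun h =>
    let: (q', w, mv) := tm_delta M q h in
    match mv with
    | MoveS => pushcell (stk 2) w ;; ret 8 (inl q')
    | MoveR => pushcell (stk 1) w ;; ret 8 (inl q')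
    | MoveL => pushcell (stk 2) w ;;
               bind (popcell (stk 1)) (fun c => pushcell (stk 2) c ;; ret 8 (inl q'))
    end).

Lemma runs_sim_body q l r s0 st : size st = 5 -> q != tm_halt M ->
  exists q' l' r', tm_step (conf q l r) = conf q' l' r' /\
    runs (sim_body q) [:: s0, cells l, cells r & st] (inl q')
      [:: s0, cells l', cells r' & st] 8.
Proof.
move=> sz nh; rewrite /tm_step /sim_body /= (negPf nh).
have H1 := @runs_popcell (stk 2) r [:: s0, cells l, cells r & st] isT erefl.
case ed: (tm_delta M q (head None r)) H1 => [[q' w] mv] /= H1.
case: mv ed => ed.
- exists q', (behead l), (head None l :: w :: behead r); split; first by case: (l).
  apply: (runs_bind (n2 := 6) H1); rewrite ed.
  apply: (runs_seqm (n1 := 2) (n2 := 4)); first exact: runs_pushcell.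
  apply: (runs_bind (n1 := 2) (n2 := 2)).
    exact: (@runs_popcell (stk 1) l).
  by apply: (runs_seqm (n1 := 2) (n2 := 0)); [exact: runs_pushcell|exact: runs_ret].
- exists q', (w :: l), (behead r); split.
    by case: (r) => [|h [|h' r']].
  apply: (runs_le (n := 2 + (2 + 0))) => //; apply: runs_bind H1 _; rewrite ed.
  by apply: runs_seqm; [exact: runs_pushcell|exact: runs_ret].
- exists q', l, (w :: behead r); split=> //.
  apply: (runs_le (n := 2 + (2 + 0))) => //; apply: runs_bind H1 _; rewrite ed.
  by apply: runs_seqm; [exact: runs_pushcell|exact: runs_ret].
Qed.

Lemma runs_sim_loop t q l r s0 st : size st = 5 ->
  cf_state (iter t (tm_step (M := M)) (conf q l r)) = tm_halt M ->
  exists l' r', iter t (tm_step (M := M)) (conf q l r) = conf (tm_halt M) l' r' /\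
    runs (loop sim_body q) [:: s0, cells l, cells r & st] tt
      [:: s0, cells l', cells r' & st] (9 * t + 1).
Proof.
move=> sz; elim: t q l r => [|t IH] q l r.
  move=> /= ->; exists l, r; split=> //; apply: (runs_loop_exit (n := 0)).
  by rewrite /sim_body eqxx; apply: runs_ret.
(* The Turing machine may halt before time [t]; its halting configuration is then fixed. *)
rewrite iterSr; case: (q =P tm_halt M) => [->|/eqP nh].
  have -> : tm_step (conf (tm_halt M) l r) = conf (tm_halt M) l r.
    by rewrite /tm_step eqxx.
  move=> /IH [l' [r' [e H]]]; exists l', r'; split=> //.
  by apply: runs_le H; lia.
have [q' [l1 [r1 [-> H1]]]] := runs_sim_body l r s0 sz nh.
move=> /IH [l' [r' [e H]]]; exists l', r'; split=> //.
by apply: runs_le (runs_loop_next H1 H); lia.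
Qed.

(* Stacks 1 and 2 are the left and right halves of the tape; stack 4 records the
   input length in unary. *)
Definition load : mach 8 unit :=
  whilepop (stk 0) (fun b => push (stk 3) b ;; push (stk 4) true) ;;
  whilepop (stk 3) (fun b => pushcell (stk 2) (Some b)).

Definition unload_body (_ : unit) : mach 8 (unit + unit) :=
  bind (popcell (stk 2)) (fun c => if c is Some b then push (stk 3) b ;; ret 8 (inl tt)
                                   else ret 8 (inr tt)).

Definition unload : mach 8 unit :=
  loop unload_body tt ;; whilepop (stk 3) (fun b => push (stk 0) b).

Definition sim : mach 8 unit := load ;; loop sim_body (tm_start M) ;; unload.

Lemma runs_load1 x t n a b c d e :
  runs (whilepop (stk 0) (fun b => push (stk 3) b ;; push (stk 4) true))
    [:: x; a; b; t; nseq n true; c; d; e] tt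
    [:: [::]; a; b; catrev x t; nseq (size x + n) true; c; d; e] (4 * size x + 2).
Proof.
elim: x t n => [|h x IH] t n; first by exact: runs_whilepop_nil.
have -> : 4 * size (h :: x) + 2 = 2.+2 + (4 * size x + 2) by rewrite /=; lia.
apply: runs_whilepop_cons; first by [].
  by apply: (runs_seqm (n1 := 1) (n2 := 1)); exact: runs_push.
by have := IH (h :: t) n.+1; rewrite addnS.
Qed.

Lemma runs_load2 x l a b c d e f :
  runs (whilepop (stk 3) (fun b => pushcell (stk 2) (Some b)))
    [:: a; b; cells l; x; c; d; e; f] tt
    [:: a; b; cells (catrev (map Some x) l); [::]; c; d; e; f] (4 * size x + 2).
Proof.
elim: x l => [|h x IH] l; first by exact: runs_whilepop_nil.
have -> : 4 * size (h :: x) + 2 = 2.+2 + (4 * size x + 2) by rewrite /=; lia.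
apply: runs_whilepop_cons; first by [].
  exact: runs_pushcell.
exact: (IH (Some h :: l)).
Qed.

Lemma runs_load x :
  runs load (x :: nseq 7 [::]) tt
    [:: [::]; [::]; cells (map Some x); [::]; nseq (size x) true; [::]; [::]; [::]]
    (8 * size x + 4).
Proof.
have -> : 8 * size x + 4 = (4 * size x + 2) + (4 * size x + 2) by lia.
apply: runs_seqm; first exact: (@runs_load1 x [::] 0).
have := @runs_load2 (catrev x [::]) [::] [::] [::] (nseq (size x) true) [::] [::] [::].
by rewrite addn0 !catrevE !cats0 size_rev map_rev revK.
Qed.

(** The loop stops at a coded blank or at the end of the stack, just as [nonblank_prefix] does. The
    bits arrive reversed and are turned round by the second half of [unload]. *)
Lemma runs_unload_loop r t s l a b c d :
  exists r', runs (loop unload_body tt) [:: s; l; cells r; t; a; b; c; d] tt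
    [:: s; l; r'; catrev (nonblank_prefix (head None r :: behead r)) t; a; b; c; d]
    (4 * size r + 3).
Proof.
elim: r t => [|h r IH] t.
  exists [::]; apply: (runs_loop_exit (n := 2 + 0)).
  by apply: runs_bind; [exact: (@runs_popcell (stk 2) [::])|exact: runs_ret].
case: h => [h|]; last first.
  exists (cells r); apply: (@runs_le _ _ _ _ _ _ 3); first by lia.
  apply: (runs_loop_exit (n := 2 + 0)).
  by apply: runs_bind; [exact: (@runs_popcell (stk 2) (None :: r))|exact: runs_ret].
have [r' H] := IH (h :: t); exists r'.
have -> : 4 * size (Some h :: r) + 3 = (2 + (1 + 0)).+1 + (4 * size r + 3).
  by rewrite /=; lia.
apply: runs_loop_next.
  apply: runs_bind; first exact: (@runs_popcell (stk 2) (Some h :: r)).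
  by apply: runs_seqm; [exact: runs_push|exact: runs_ret].
by case: (r) H => [|[h'|] r0].
Qed.

Lemma runs_move_back x t a b c d e f :
  runs (whilepop (stk 3) (fun b => push (stk 0) b))
    [:: t; a; b; x; c; d; e; f] tt
    [:: catrev x t; a; b; [::]; c; d; e; f] (3 * size x + 2).
Proof.
elim: x t => [|h x IH] t; first by exact: runs_whilepop_nil.
have -> : 3 * size (h :: x) + 2 = 1.+2 + (3 * size x + 2) by rewrite /=; lia.
apply: runs_whilepop_cons; [by []|exact: runs_push|exact: IH].
Qed.

Lemma size_nonblank_prefix r : size (nonblank_prefix r) <= size r.
Proof. by elim: r => //= -[b|]. Qed.

Lemma size_right_step (c : config M) :
  size (cf_right (tm_step c)) <= (size (cf_right c)).+1.
Proof.
rewrite /tm_step; case: ifP => // _; case: tm_delta => [[q' w] []] /=.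
- by case: (cf_left c).
- by case: (cf_right c) => //= h r; apply: leqW; apply: leqnSn.
- by [].
Qed.

Lemma size_right_iter t (c : config M) :
  size (cf_right (iter t (tm_step (M := M)) c)) <= size (cf_right c) + t.
Proof.
elim: t => [|t IH]; first by rewrite addn0.
by rewrite addnS; apply: leq_trans (size_right_step _) _.
Qed.

Lemma runs_sim x t y : 
  let c := iter t (tm_step (M := M)) (tm_init M x) in
  cf_state c = tm_halt M -> tm_output c = y ->
  size y <= size x + t + 1 /\
  exists g1 g2, runs sim (x :: nseq 7 [::]) tt
    [:: y; g1; g2; [::]; nseq (size x) true; [::]; [::]; [::]]
    (20 * (size x + t + 1)).
Proof.
have ini : tm_init M x = conf (tm_start M) [::] (map Some x) by case: x.
move=> c; rewrite /c ini => hc ey.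
have [l [r [ec H2]]] := runs_sim_loop [::]
   (erefl : size [:: [::]; nseq (size x) true; [::]; [::]; [::]] = 5) hc.
have sr : size (behead r) <= size x + t.
  have := size_right_iter t (conf (tm_start M) [::] (map Some x)).
  rewrite ec /= => le; apply: leq_trans le _.
  by rewrite leq_add2r size_behead size_map leq_pred.
have yE : y = nonblank_prefix (head None r :: behead r) by rewrite -ey ec.
have sy : size y <= size x + t + 1.
  rewrite yE; apply: leq_trans (size_nonblank_prefix _) _ => /=; lia.
split=> //.
have [r' H3] := runs_unload_loop r [::] [::] (cells l) (nseq (size x) true) [::] [::] [::].
rewrite -yE in H3; exists (cells l), r'.
have H4 := @runs_move_back (catrev y [::]) [::] (cells l) r' (nseq (size x) true) [::] [::] [::].
have e : catrev (catrev y [::]) [::] = y.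
  by rewrite [catrev y _]catrevE cats0 catrev_rev cats0.
rewrite e in H4.
have sr' : size r <= size x + t + 1 by rewrite size_behead in sr; lia.
apply: runs_le (runs_seqm (runs_load x) (runs_seqm H2 (runs_seqm H3 H4))).
rewrite catrevE cats0 size_rev; lia.
Qed.

End Sim.

(** One polynomial bounds both the time and the output length. The machine leaves the input length
    in unary on stack 4 and clean scratch stacks for the programs that follow; [g1] and [g2] are
    leftovers of the tape. *)
Lemma sim_PolyTime f : PolyTime f -> exists p, polyb p /\
  exists m : mach 8 unit, forall x, size (f x) <= p (size x) /\ exists g1 g2,
    runs m (x :: nseq 7 [::]) tt
      [:: f x; g1; g2; [::]; nseq (size x) true; [::]; [::]; [::]] (p (size x)).
Proof.
move=> [M [a [d H]]]; exists (fun n => 20 * (n + (a * n ^ d + a) + 1)); split.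
  by repeat (exact: polyb_affine || exact: polyb_id || apply: polyb_const ||
    apply: polyb_add || apply: polyb_mul).
exists (sim M) => x; have [t [le_t [hc ey]]] := H x.
have [sy [g1 [g2 R]]] := runs_sim hc ey; split; first by lia.
by exists g1, g2; apply: runs_le R; rewrite leq_mul2l /= !leq_add.
Qed.

(** * Stack programs for the two circuit transformations *)

Notation nones m := (nseq m true).

Definition move_ones (i j : 'I_8) : mach 8 unit := whilepop i (fun _ => push j true).

Definition copy_ones (i j t : 'I_8) : mach 8 unit :=
  move_ones i t ;; whilepop t (fun _ => push i true ;; push j true).

Lemma set_nthC (st : stacks) (i j : nat) s s' : i != j ->
  set_nth [::] (set_nth [::] st i s) j s' = set_nth [::] (set_nth [::] st j s') i s.
Proof. by move=> ne; rewrite set_set_nth (negPf ne). Qed.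

Lemma nth_set_ne (st : stacks) (i j : nat) s : i != j ->
  nth [::] (set_nth [::] st i s) j = nth [::] st j.
Proof. by rewrite nth_set_nth /= eq_sym => /negPf ->. Qed.

Lemma nth_set_eq (st : stacks) (i : nat) s : nth [::] (set_nth [::] st i s) i = s.
Proof. by rewrite nth_set_nth /= eqxx. Qed.

Lemma set_set_eq (st : stacks) (i : nat) s s' :
  set_nth [::] (set_nth [::] st i s) i s' = set_nth [::] st i s'.
Proof. by rewrite set_set_nth eqxx. Qed.

Lemma size_set (st : stacks) (j : 'I_8) s : size st = 8 -> size (set_nth [::] st j s) = 8.
Proof. by rewrite size_set_nth => ->; apply/maxn_idPr. Qed.

Lemma nseq_catS m (s : seq bool) : nones m ++ true :: s = nones m.+1 ++ s.
Proof. by elim: m => //= m ->. Qed.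

Lemma runs_move_ones (i j : 'I_8) m st :
  size st = 8 -> i != j :> nat -> nth [::] st i = nones m ->
  runs (move_ones i j) st tt
    (set_nth [::] (set_nth [::] st i [::]) j (nones m ++ nth [::] st j)) (3 * m + 2).
Proof.
move=> sz ne; have ne' : j != i :> nat by rewrite eq_sym.
elim: m st sz => [|m IH] st sz e.
  apply: runs_set (runs_whilepop_nil _ e).
  by rewrite set_nthC // set_nth_id ?sz // -[X in set_nth _ _ _ X]e set_nth_id ?sz.
have -> : 3 * m.+1 + 2 = 1.+2 + (3 * m + 2) by lia.
apply: (runs_whilepop_cons (n1 := 1) (s := nones m) e); first exact: runs_push.
rewrite nth_set_ne //; set st1 := set_nth _ _ j _.
have := IH st1; rewrite !size_set // nth_set_ne // nth_set_eq => /(_ erefl erefl).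
by apply: runs_set; rewrite nth_set_eq nseq_catS /st1 set_nthC // set_set_eq [LHS]set_nthC // set_set_eq.
Qed.

Lemma runs_copy_ones (i j t : 'I_8) m st :
  size st = 8 -> i != j :> nat -> i != t :> nat -> j != t :> nat ->
  nth [::] st i = nones m -> nth [::] st t = [::] ->
  runs (copy_ones i j t) st tt
    (set_nth [::] st j (nones m ++ nth [::] st j)) (7 * m + 4).
Proof.
move=> sz nij nit njt ei et.
have nji : j != i :> nat by rewrite eq_sym.
have nti : t != i :> nat by rewrite eq_sym.
have ntj : t != j :> nat by rewrite eq_sym.
have -> : 7 * m + 4 = (3 * m + 2) + (4 * m + 2) by lia.
have H := runs_move_ones sz nit ei; apply: runs_seqm H _.
rewrite et cats0; set st1 := set_nth _ _ t _.
have back q st0 : size st0 = 8 -> nth [::] st0 t = nones q ->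
  runs (whilepop t (fun _ => push i true ;; push j true)) st0 tt
    (set_nth [::] (set_nth [::] (set_nth [::] st0 t [::]) i (nones q ++ nth [::] st0 i))
       j (nones q ++ nth [::] st0 j)) (4 * q + 2).
  elim: q st0 => [|q IH] st0 sz0 e0.
    apply: runs_set (runs_whilepop_nil _ e0).
    by rewrite -[X in set_nth _ st0 _ X]e0 !set_nth_id ?sz0.
  have -> : 4 * q.+1 + 2 = 2.+2 + (4 * q + 2) by lia.
  apply: (runs_whilepop_cons (n1 := 2) (s := nones q) e0).
    by apply: (runs_seqm (n1 := 1) (n2 := 1)); exact: runs_push.
  rewrite !(nth_set_ne _ _ nij) !(nth_set_ne _ _ nti) !(nth_set_ne _ _ ntj).
  set st2 := set_nth _ _ j _.
  have := IH st2; rewrite !size_set // (nth_set_ne _ _ njt) (nth_set_ne _ _ nit) nth_set_eq.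
  move=> /(_ erefl erefl); apply: runs_set.
  rewrite nth_set_eq (nth_set_ne _ _ nji) nth_set_eq !nseq_catS /st2.
  rewrite [set_nth _ (set_nth _ _ j _) t _]set_nthC // [set_nth _ (set_nth _ _ i _) t _]set_nthC //.
  by rewrite set_set_eq [set_nth _ (set_nth _ _ j _) i _]set_nthC // !set_set_eq.
have := back m st1; rewrite /st1 !size_set // nth_set_eq => /(_ erefl erefl).
apply: runs_set; rewrite set_set_eq !(nth_set_ne _ _ nti) !(nth_set_ne _ _ ntj).
rewrite nth_set_eq (nth_set_ne _ _ nij) cats0.
rewrite [set_nth _ (set_nth _ _ i _) t _]set_nthC // set_set_eq.
by congr set_nth; rewrite -ei -[X in set_nth _ st _ X]et !set_nth_id ?sz.
Qed.

Definition read_ones (p : mach 8 unit) : mach 8 unit :=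
  loop (fun _ : unit => bind (pop (stk 0)) (fun o =>
    if o is Some true then p ;; ret 8 (inl tt) else ret 8 (inr tt))) tt.

(** [F i] is the content of the other stacks after [i] ones have been read. The terminating zero is
    consumed as well. *)
Lemma runs_read_ones p (F : nat -> stacks) c m i s :
  (forall i s, runs p (s :: F i) tt (s :: F i.+1) c) ->
  runs (read_ones p) ((nones m ++ false :: s) :: F i) tt (s :: F (i + m))
    ((c + 2) * m + 2).
Proof.
move=> Hp; elim: m i => [|m IH] i.
  rewrite muln0 addn0; apply: (runs_loop_exit (n := 1 + 0)).
  by apply: runs_bind; [exact: runs_pop|exact: runs_ret].
have -> : (c + 2) * m.+1 + 2 = (1 + (c + 0)).+1 + ((c + 2) * m + 2) by rewrite mulnS; lia.
apply: runs_loop_next.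
  apply: runs_bind; first exact: runs_pop.
  by apply: runs_seqm; [exact: Hp|exact: runs_ret].
by rewrite addnS; exact: IH.
Qed.

Definition discard0 : mach 8 unit := bind (pop (stk 0)) (fun _ => ret 8 tt).

Lemma runs_discard0 b s st : runs discard0 ((b :: s) :: st) tt (s :: st) 1.
Proof. by apply: (runs_bind (n1 := 1) (n2 := 0)); [exact: runs_pop|exact: runs_ret]. Qed.

Section Prep.
Variables qv qm : nat.

(* H on qubit [qv + qm + t], then CNOT from it to qubit [qv + t]. *)
Definition gate_str t s : seq bool :=
  false :: nones qm ++ nones (qv + t) ++ [:: false, true, true, false &
  nones qm ++ nones (qv + t) ++ false :: nones (qv + t) ++ false :: s].

Fixpoint prep_str k s := if k is t.+1 then gate_str t (prep_str t s) else s.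

Definition emit (bs : seq bool) : mach 8 unit :=
  foldr (fun b p => push (stk 0) b ;; p) (ret 8 tt) bs.

Lemma runs_emit bs s st : runs (emit bs) (s :: st) tt (catrev bs s :: st) (size bs).
Proof.
elim: bs s => [|b bs IH] s; first exact: runs_ret.
by apply: (runs_seqm (n1 := 1) (n2 := size bs)); [exact: runs_push|exact: IH].
Qed.

Definition copy5 := copy_ones (stk 5) (stk 0) (stk 3).
Definition copy6 := copy_ones (stk 6) (stk 0) (stk 3).

(** The string is produced from its end, as pushing prepends. Stack 5 holds [qv + t] and stack 6
    holds [qm]; the final push advances [t]. *)
Definition gate_prog : mach 8 unit :=
  emit [:: false] ;; copy5 ;; emit [:: false] ;; copy5 ;; copy6 ;;
  emit [:: false; true; true; false] ;; copy5 ;; copy6 ;; emit [:: false] ;;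
  push (stk 5) true.

Lemma runs_gate_prog t s g h n C : t < qm ->
  runs gate_prog [:: s; g; h; [::]; n; nones (qv + t); nones qm; C] tt
    [:: gate_str t s; g; h; [::]; n; nones (qv + t.+1); nones qm; C]
    (40 * (qv + qm + 1)).
Proof.
move=> lt; rewrite addnS.
apply: (@runs_le _ _ _ _ _ _ (1 + ((7 * (qv + t) + 4) + (1 + ((7 * (qv + t) + 4) +
  ((7 * qm + 4) + (4 + ((7 * (qv + t) + 4) + ((7 * qm + 4) + (1 + 1)))))))))).
  lia.
do 9 (apply: runs_seqm; [by [apply: runs_emit|apply: runs_copy_ones]|]).
exact: runs_push.
Qed.

(* The gates come out in decreasing order of [t], as pushing writes backwards. *)
Definition prep_prog : mach 8 unit :=
  read_ones (push (stk 5) true) ;;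
  read_ones (push (stk 6) true ;; push (stk 7) true) ;;
  discard0 ;; discard0 ;; whilepop (stk 7) (fun _ => gate_prog) ;;
  emit [:: false; true; false] ;; copy6 ;; emit [:: false] ;; copy5.

Lemma runs_gates r t s g h n : t + r <= qm ->
  runs (whilepop (stk 7) (fun _ => gate_prog))
    [:: prep_str t s; g; h; [::]; n; nones (qv + t); nones qm; nones r] tt
    [:: prep_str (t + r) s; g; h; [::]; n; nones (qv + (t + r)); nones qm; [::]]
    ((40 * (qv + qm + 1) + 2) * r + 2).
Proof.
elim: r t => [|r IH] t le.
  by rewrite muln0 addn0; exact: runs_whilepop_nil.
set c := 40 * _.
have -> : (c + 2) * r.+1 + 2 = c.+2 + ((c + 2) * r + 2) by rewrite mulnS; lia.
apply: runs_whilepop_cons; first by [].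
  by apply: runs_gate_prog; lia.
rewrite -(addSnnS t r). refine (IH t.+1 _).
by rewrite addSnnS.
Qed.

Lemma runs_prep_prog G g h n :
  runs prep_prog
    [:: nones qv ++ false :: nones qm ++ [:: false, true, false & G];
        g; h; [::]; n; [::]; [::]; [::]] tt
    [:: nones (qv + qm) ++ false :: nones qm ++ [:: false, true, false &
          prep_str qm G];
        g; h; [::]; n; nones (qv + qm); nones qm; [::]]
    (100 * (qv + qm + 1) * (qv + qm + 1)).
Proof.
apply: (@runs_le _ _ _ _ _ _ (((1 + 2) * qv + 2) + (((2 + 2) * qm + 2) + (1 + (1 +
  (((40 * (qv + qm + 1) + 2) * qm + 2) + (3 + ((7 * qm + 4) + (1 + (7 * (qv + qm) + 4)))))))))).
  rewrite -mulnA; set u := qv + qm + 1.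
  have : (40 * u + 2) * qm <= 42 * u * u by rewrite leq_mul //; lia.
  have : u <= u * u by rewrite leq_pmulr; lia.
  by rewrite -!mulnA; lia.
apply: runs_seqm.
  apply: (@runs_read_ones _ (fun i => [:: g; h; [::]; n; nones i; [::]; [::]]) 1 qv 0) => i s.
  exact: runs_push.
rewrite add0n; apply: runs_seqm.
  apply: (@runs_read_ones _ (fun i => [:: g; h; [::]; n; nones qv; nones i; nones i]) 2 qm 0) => i s.
  by apply: (runs_seqm (n1 := 1) (n2 := 1)); exact: runs_push.
(* The two discarded bits are the unary code of the number of proofs, which is 1; it is emitted
   again after the gates. *)
apply: runs_seqm; first exact: runs_discard0.
apply: runs_seqm; first exact: runs_discard0.
apply: runs_seqm.
  by rewrite -[qv in nones qv]addn0; apply: (@runs_gates qm 0).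
apply: runs_seqm; first exact: runs_emit.
apply: runs_seqm; first by apply: runs_copy_ones.
apply: runs_seqm; first exact: runs_emit.
exact: runs_copy_ones.
Qed.
End Prep.

Lemma PolyTime_prep f (qv qm : seq bool -> nat) (G : seq bool -> seq bool) :
  PolyTime f ->
  (forall x, f x = nones (qv x) ++ false :: nones (qm x) ++ [:: false, true, false & G x]) ->
  PolyTime (fun x => nones (qv x + qm x) ++ false :: nones (qm x) ++
     [:: false, true, false & prep_str (qv x) (qm x) (qm x) (G x)]).
Proof.
move=> /sim_PolyTime [p [pb [m Hm]]] fE.
apply: (@PolyTime_of_mach 7 (m ;; prep_prog) _
   (fun n => p n + 100 * (p n + 1) * (p n + 1))).
  by repeat (exact: pb || apply: polyb_const || apply: polyb_add || apply: polyb_mul).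
move=> x; have [le [g1 [g2 R]]] := Hm x; rewrite fE in R le.
eexists; apply: runs_seqm R _; apply: runs_le (runs_prep_prog _ _ _ _ _ _).
(* Sizes are written in unary, so the length of [f x] bounds [qv x + qm x]. *)
rewrite !size_cat /= !size_cat !size_nseq /= in le.
by rewrite leq_mul ?leq_mul2l //=; lia.
Qed.

Definition push_ones c : mach 8 unit := iter c (seqm (push (stk 5) true)) (ret 8 tt).

Lemma runs_push_ones c s g h n A :
  runs (push_ones c) [:: s; g; h; [::]; n; A; [::]; [::]] tt
    [:: s; g; h; [::]; n; nones c ++ A; [::]; [::]] c.
Proof.
elim: c A => [|c IH] A; first exact: runs_ret.
apply: (runs_seqm (n1 := 1) (n2 := c)); first exact: runs_push.
by rewrite -nseq_catS; exact: IH.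
Qed.

(** Each one on stack 5 turns into [n.+1] ones, where [n] is the input length kept on stack 4.
    Iterating it from [c] gives [c * n.+1 ^ e]. *)
Definition mult_prog : mach 8 unit :=
  whilepop (stk 5) (fun _ => push (stk 6) true ;; copy_ones (stk 4) (stk 6) (stk 3)) ;;
  move_ones (stk 6) (stk 5).

Lemma runs_mult_prog m n s g h :
  runs mult_prog [:: s; g; h; [::]; nones n; nones m; [::]; [::]] tt
    [:: s; g; h; [::]; nones n; nones (m * n.+1); [::]; [::]]
    ((7 * n + 7) * m + 2 + (3 * (m * n.+1) + 2)).
Proof.
apply: runs_seqm.
  have H q : runs (whilepop (stk 5) (fun _ => push (stk 6) true ;; copy_ones (stk 4) (stk 6) (stk 3)))
    [:: s; g; h; [::]; nones n; nones m; nones q; [::]] tt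
    [:: s; g; h; [::]; nones n; [::]; nones (m * n.+1 + q); [::]] ((7 * n + 7) * m + 2).
    elim: m q => [|m IH] q; first by rewrite muln0; exact: runs_whilepop_nil.
    have -> : (7 * n + 7) * m.+1 + 2 = (1 + (7 * n + 4)).+2 + ((7 * n + 7) * m + 2).
      by rewrite mulnS; lia.
    apply: runs_whilepop_cons; first by [].
      by apply: runs_seqm; [exact: runs_push|apply: runs_copy_ones].
    have := IH (n + q.+1); rewrite (nseqD n q.+1).
    by have -> : m * n.+1 + (n + q.+1) = m.+1 * n.+1 + q by rewrite mulSn; lia.
  by have := H 0; rewrite addn0; apply.
have := @runs_move_ones (stk 6) (stk 5) (m * n.+1)
  [:: s; g; h; [::]; nones n; [::]; nones (m * n.+1); [::]] erefl isT erefl.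
by rewrite /= cats0.
Qed.

(** The three sizes at the head of the description are erased and replaced, from the last to the
    first, by one proof, zero proof qubits and a work register of [c * n.+1 ^ e] qubits. *)
Definition pad_prog c e : mach 8 unit :=
  read_ones (ret 8 tt) ;; read_ones (ret 8 tt) ;; read_ones (ret 8 tt) ;;
  emit [:: false; true; false; false] ;;
  push_ones c ;; iter e (fun p => p ;; mult_prog) (ret 8 tt) ;; move_ones (stk 5) (stk 0).

Lemma runs_mults c e : exists q, polyb q /\ forall n s g h,
  runs (iter e (fun p => p ;; mult_prog) (ret 8 tt))
    [:: s; g; h; [::]; nones n; nones c; [::]; [::]] tt
    [:: s; g; h; [::]; nones n; nones (c * n.+1 ^ e); [::]; [::]] (q n).
Proof.
elim: e => [|e [q [pq IH]]].
  exists (fun _ => 0); split; first exact: polyb_const.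
  by move=> n s g h; rewrite muln1; apply: runs_ret.
exists (fun n => q n + ((7 * n + 7) * (c * n.+1 ^ e) + 2 + (3 * (c * n.+1 ^ e * n.+1) + 2))).
split.
  have pe : polyb (fun n => n.+1 ^ e) by exists 1, e => n; rewrite mul1n.
  have pS : polyb (fun n => n.+1) by exists 1, 1 => n; rewrite mul1n.
  by repeat (exact: pq || exact: pe || exact: pS || exact: polyb_id ||
    apply: polyb_const || apply: polyb_add || apply: polyb_mul).
move=> n s g h; apply: runs_seqm; first exact: IH.
by rewrite expnSr mulnA; exact: runs_mult_prog.
Qed.

(** A verifier's register size may depend on the input length only, so [P] is computed from the
    polynomial bound on the output of [f]. Exceeding the length of [f x] makes room for every qubit
    index in it. *)
Lemma PolyTime_pad f (qv qm k : seq bool -> nat) (G : seq bool -> seq bool) :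
  PolyTime f ->
  (forall x, f x = nones (qv x) ++ false :: nones (qm x) ++ false :: nones (k x) ++ false :: G x) ->
  exists P : nat -> nat, (forall x, size (f x) < P (size x)) /\
    PolyTime (fun x => nones (P (size x)) ++ [:: false, false, true, false & G x]).
Proof.
move=> /sim_PolyTime [p [pb [m Hm]]] fE.
have [c [e He]] := polyb_add pb (polyb_const 1).
exists (fun n => c * n.+1 ^ e); split.
  by move=> x; have [le _] := Hm x; apply: leq_trans (He _); rewrite addn1 ltnS.
have [q [pq Hq]] := runs_mults c e.
apply: (@PolyTime_of_mach 7 (m ;; pad_prog c e) _
  (fun n => p n + (6 * p n + 6 + 4 + c + q n + (3 * (c * n.+1 ^ e) + 2)))).
  have pe : polyb (fun n => n.+1 ^ e) by exists 1, e => n; rewrite mul1n.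
  by repeat (exact: pb || exact: pq || exact: pe || apply: polyb_const ||
    apply: polyb_add || apply: polyb_mul).
move=> x; have [le [g1 [g2 R]]] := Hm x; rewrite fE in R le.
eexists; apply: runs_seqm R _.
rewrite !size_cat /= !size_cat /= !size_cat !size_nseq /= in le.
set n := size x in le *.
apply: (@runs_le _ _ _ _ _ _ (((0 + 2) * qv x + 2) + (((0 + 2) * qm x + 2) +
  (((0 + 2) * k x + 2) + (4 + (c + (q n + (3 * (c * n.+1 ^ e) + 2)))))))); first by lia.
do 3 (apply: runs_seqm;
  first by apply: (@runs_read_ones _ (fun _ => [:: g1; g2; [::]; nones n; [::]; [::]; [::]]) 0 _ 0)
    => i s; exact: runs_ret).
apply: runs_seqm; first exact: runs_emit.
apply: runs_seqm; first exact: runs_push_ones.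
rewrite cats0; apply: runs_seqm; first exact: Hq.
exact: runs_move_ones.
Qed.

(** * Circuit descriptions *)

Lemma unary_nats_cat acc m s :
  unary_nats acc (nones m ++ false :: s) = omap (cons (acc + m)) (unary_nats 0 s).
Proof. by elim: m acc => [|m IH] acc; rewrite ?addn0 // addnS -addSn -IH. Qed.

Lemma unary_nats_cons acc s n l : unary_nats acc s = Some (n :: l) ->
  exists m s', [/\ n = acc + m, s = nones m ++ false :: s' & unary_nats 0 s' = Some l].
Proof.
elim: s acc => [|[] s IH] acc /=; first by case: acc.
  by move=> /IH [m [s' [-> -> e]]]; exists m.+1, s'; rewrite addnS.
by case e: unary_nats => //= -[<- <-]; exists 0, s; rewrite addn0.
Qed.

(** A number written in unary is smaller than the length of its code with the terminator. *)
Lemma unary_nats_bound acc s l : unary_nats acc s = Some l ->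
  all (fun n => n < acc + size s) l.
Proof.
elim: s acc l => [|b s IH] acc l /=; first by case: acc => // -[<-].
case: b => [/IH|]; first by rewrite addSnnS.
case e: unary_nats => [l'|] //= [<-] /=; apply/andP; split; first by lia.
by apply: sub_all (IH _ _ e) => n; lia.
Qed.

Definition circ_str qv qm k G : seq bool :=
  nones qv ++ false :: nones qm ++ false :: nones k ++ false :: G.

Definition gates_of_str (G : seq bool) : option (seq gate) :=
  obind parse_gates (unary_nats 0 G).

Lemma decode_circ_str qv qm k G gs : gates_of_str G = Some gs ->
  circ_ok (Circ qv qm k gs) -> decode (circ_str qv qm k G) = Some (Circ qv qm k gs).
Proof.
rewrite /gates_of_str /decode /circ_str !unary_nats_cat !add0n.
by case: (unary_nats 0 G) => //= gl -> ->.
Qed.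

Lemma drop_circ_str qv qm k G : drop (qv + qm + k + 3) (circ_str qv qm k G) = G.
Proof.
have drop_ones m n s : drop (m + n).+1 (nones m ++ false :: s) = drop n s.
  by elim: m => [|m IH]; rewrite ?drop0.
have -> : qv + qm + k + 3 = (qv + (qm + (k + 0).+1).+1).+1 by lia.
by rewrite /circ_str !drop_ones drop0.
Qed.

(** The gate part is an explicit suffix of [s], so it can be named as a function of the input
    without choice. *)
Lemma decode_inv s c : decode s = Some c ->
  let G := drop (cqV c + cqM c + ck c + 3) s in
  [/\ circ_ok c, s = circ_str (cqV c) (cqM c) (ck c) G &
      gates_of_str G = Some (cgates c)].
Proof.
rewrite /decode; case e: unary_nats => [[|qv [|qm [|k gl]]]|] //.
case eg: parse_gates => [gs|] //; case: ifP => // ok [<-].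
have [qv' [s1 [E1 -> e1]]] := unary_nats_cons e.
have [qm' [s2 [E2 -> e2]]] := unary_nats_cons e1.
have [k' [s3 [E3 -> e3]]] := unary_nats_cons e2.
rewrite !add0n in E1 E2 E3; subst qv' qm' k'.
by rewrite -/(circ_str qv qm k s3) drop_circ_str /gates_of_str e3.
Qed.

Fixpoint prep_gates qv qm k gs : seq gate :=
  if k is t.+1 then
    [:: GH (qv + qm + t), GCNOT (qv + qm + t) (qv + t) & prep_gates qv qm t gs]
  else gs.

Lemma gates_of_prep_str qv qm k G gs : gates_of_str G = Some gs ->
  gates_of_str (prep_str qv qm k G) = Some (prep_gates qv qm k gs).
Proof.
move=> eG; elim: k => //= k; rewrite /gates_of_str; set s := prep_str _ _ _ _.
have two r : nones qm ++ nones (qv + k) ++ r = nones (qv + qm + k) ++ r.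
  by rewrite catA -nseqD; congr (nseq _ _ ++ _); lia.
have -> : gate_str qv qm k s = nones 0 ++ false :: nones (qv + qm + k) ++
    false :: nones 2 ++ false :: nones (qv + qm + k) ++ false :: nones (qv + k) ++ false :: s.
  by rewrite /gate_str !two.
by rewrite !unary_nats_cat; case: unary_nats => //= gl ->.
Qed.

(** The index range comes from the bound on the parsed numbers; validity for [N] supplies that
    control and target differ. *)
Lemma parse_gates_ok N P l gs : parse_gates l = Some gs ->
  all (fun n => n < P) l -> all (gate_ok N) gs -> all (gate_ok P) gs.
Proof.
have [n] := ubnP (size l); elim: n l gs => // n IH l gs.
case: l => [|[|[|[|m]]] [|i r]] //= le; first by case=> <-.
- case e: parse_gates => [gs'|] //= [<-] /andP[_ /andP[ip rp]] /= /andP[_ ok].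
  by rewrite ip; apply: IH e rp ok; lia.
- case e: parse_gates => [gs'|] //= [<-] /andP[_ /andP[ip rp]] /= /andP[_ ok].
  by rewrite ip; apply: IH e rp ok; lia.
- case: r le => [|b r] //= le.
  case e: parse_gates => [gs'|] //= [<-] /and4P[_ ip bp rp] /= /andP[/and3P[_ _ ne] ok].
  by rewrite ip bp ne; apply: IH e rp ok; lia.
Qed.

(** * Amplitudes *)

Import Order.TTheory GRing.Theory Num.Theory.
Local Open Scope ring_scope.

Section Amplitudes.
Variable R : realType.
Local Notation C := (R[i]).

Definition apply_gates N (gs : seq gate) (st : bits N -> C) : bits N -> C :=
  foldl (fun s g => apply_gate g s) st gs.

Lemma sqn_ge0 (z : C) : 0 <= sqn z.
Proof. by rewrite addr_ge0 ?sqr_ge0. Qed.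

Lemma sqn_eq0 (z : C) : (sqn z == 0) = (z == 0).
Proof.
case: z => a b; rewrite /sqn /= paddr_eq0 ?sqr_ge0 // !sqrf_eq0.
by rewrite eq_complex.
Qed.

Lemma accept_prob_ge0 (c : circ) (st : bits (nqubits c) -> C) : 0 <= accept_prob st.
Proof. by apply: sumr_ge0 => b _; apply: sqn_ge0. Qed.

(** Reduces every acceptance question below to one nonzero accepting amplitude. *)
Lemma accept_prob_gt0 (c : circ) (st : bits (nqubits c) -> C) :
  0 < accept_prob st <-> exists2 b : bits (nqubits c), bitn b 0 & apply_gates (cgates c) st b <> 0.
Proof.
rewrite lt_def accept_prob_ge0 andbT psumr_neq0; last by move=> b _; apply: sqn_ge0.
split=> [/hasP[b _ /andP[b0]]|[b b0 nz]].
  by rewrite lt_def sqn_eq0 => /andP[/eqP nz _]; exists b.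
apply/hasP; exists b; rewrite ?mem_index_enum // b0 /= lt_def sqn_ge0 sqn_eq0 andbT.
exact/eqP.
Qed.

Lemma apply_gate_sum N (I : finType) g (a : I -> C) (st : I -> bits N -> C) :
  apply_gate g (fun b => \sum_i a i * st i b) =
  (fun b => \sum_i a i * apply_gate g (st i) b).
Proof.
apply: funext => b; case: g => [i|i|u v] //=.
  rewrite (eq_bigr _ (fun v _ => mulr_sumr _ _ _ _)) exchange_big.
  apply: eq_bigr => i0 _; rewrite mulr_sumr; apply: eq_bigr => v _.
  by rewrite mulrCA.
by rewrite mulr_sumr; apply: eq_bigr => i0 _; rewrite mulrCA.
Qed.

Lemma apply_gates_sum N (I : finType) gs (a : I -> C) (st : I -> bits N -> C) b :
  apply_gates gs (fun b => \sum_i a i * st i b) b =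
  \sum_i a i * apply_gates gs (st i) b.
Proof.
by rewrite /apply_gates; elim: gs st => //= g gs IH st; rewrite apply_gate_sum IH.
Qed.

Lemma apply_gates_scale N gs a (st : bits N -> C) b :
  apply_gates gs (fun b => a * st b) b = a * apply_gates gs st b.
Proof.
have := apply_gates_sum gs (fun _ : 'I_1 => a) (fun _ => st) b.
rewrite big_ord1 => <-; congr apply_gates.
by apply: funext => b'; rewrite big_ord1.
Qed.

Lemma bitn_ord N (b : bits N) (j : 'I_N) : bitn b j = b j.
Proof. by rewrite /bitn valK. Qed.

Lemma bitn_finfun N (f : 'I_N -> bool) i (lt : (i < N)%N) :
  bitn [ffun j => f j] i = f (Ordinal lt).
Proof. by rewrite /bitn insubT ffunE. Qed.

Lemma bitn_out N (b : bits N) i : (N <= i)%N -> bitn b i = false.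
Proof. by move=> le; rewrite /bitn insubF // ltnNge le. Qed.

Lemma bits_eqP N (b b' : bits N) :
  (forall i, (i < N)%N -> bitn b i = bitn b' i) -> b = b'.
Proof. by move=> e; apply/ffunP => j; rewrite -!bitn_ord e. Qed.

Lemma bitn_setb N (b : bits N) i v j : (j < N)%N ->
  bitn (setb b i v) j = if j == i then v else bitn b j.
Proof.
move=> lt; rewrite (bitn_finfun _ lt) /=; case: ifP => // _.
exact: esym (bitn_ord b (Ordinal lt)).
Qed.

(** * Circuits acting on the first qubits of a larger register *)

Section Glue.
Variables (n N : nat) (nN : (n <= N)%N).

Definition glue (z : bits N) (b : bits n) : bits N :=
  [ffun j : 'I_N => if (j < n)%N then bitn b j else bitn z j].

Definition low (z : bits N) : bits n := [ffun j : 'I_n => bitn z j].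

Lemma bitn_glue z b i : bitn (glue z b) i = if (i < n)%N then bitn b i else bitn z i.
Proof.
have [lt|ge] := ltnP i N; first by rewrite (bitn_finfun _ lt).
by rewrite !bitn_out ?(leq_trans nN ge) ?if_same.
Qed.

Lemma bitn_low z i : (i < n)%N -> bitn (low z) i = bitn z i.
Proof. by move=> lt; rewrite (bitn_finfun _ lt). Qed.

Lemma glue_low z : glue z (low z) = z.
Proof. by apply: bits_eqP => i lt; rewrite bitn_glue; case: ifP => // lti; rewrite bitn_low. Qed.

Lemma setb_glue z b i v : (i < n)%N -> setb (glue z b) i v = glue z (setb b i v).
Proof.
move=> lt; apply: bits_eqP => j ltj; rewrite bitn_setb // !bitn_glue.
case: ltnP => jn; first by rewrite bitn_setb.
by case: eqP jn => // ->; rewrite leqNgt lt.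
Qed.

(** Gates on the first [n] qubits never change the other bits, so the slices of the state with those
    bits fixed evolve independently. *)
Lemma apply_gates_glue gs (st : bits N -> C) z b : all (gate_ok n) gs ->
  apply_gates gs st (glue z b) = apply_gates gs (fun b => st (glue z b)) b.
Proof.
rewrite /apply_gates; elim: gs st => //= g gs IH st /andP[ok oks]; rewrite IH //.
congr (foldl _ _ _ _); apply: funext => b'.
case: g ok => [i|i|u v] /= => [lt|lt|/and3P[ltu ltv _]].
- by apply: eq_bigr => w _; rewrite bitn_glue lt setb_glue.
- by rewrite bitn_glue lt.
- by rewrite !bitn_glue ltu ltv setb_glue.
Qed.

End Glue.

Lemma zero_stateE N (b : bits N) :
  zero_state R b = if [forall i : 'I_N, ~~ bitn b i] then 1 else 0.
Proof. by congr (if _ then _ else _); apply: eq_forallb => i; rewrite bitn_ord. Qed.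

Lemma zero_amplitude_low n N (gs : seq gate) : (0 < n)%N -> (n <= N)%N ->
  all (gate_ok n) gs ->
  (exists2 b : bits N, bitn b 0 & apply_gates gs (@zero_state R N) b <> 0) <->
  (exists2 b : bits n, bitn b 0 & apply_gates gs (@zero_state R n) b <> 0).
Proof.
move=> n0 nN ok.
(* The zero state is a tensor product, and the extra qubits stay zero. *)
have E (z : bits N) (b : bits n) : apply_gates gs (@zero_state R N) (glue z b) =
  (if [forall i : 'I_N, (n <= i)%N ==> ~~ bitn z i] then 1 else 0) *
    apply_gates gs (@zero_state R n) b.
  rewrite apply_gates_glue // -apply_gates_scale; congr apply_gates.
  apply: funext => {}b; rewrite !zero_stateE.
  have -> : [forall i : 'I_N, ~~ bitn (glue z b) i] =
    [forall i : 'I_N, (n <= i)%N ==> ~~ bitn z i] && [forall i : 'I_n, ~~ bitn b i].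
    apply/forallP/andP => [H|[/forallP Hz /forallP Hb] i].
      split; apply/forallP => i.
        by apply/implyP => le; have := H i; rewrite bitn_glue // ltnNge le.
      by have := H (widen_ord nN i); rewrite bitn_glue //= ltn_ord.
    rewrite bitn_glue //; case: ltnP => [lt|ge]; first exact: (Hb (Ordinal lt)).
    exact: (implyP (Hz i)).
  by case: ifP => [/andP[-> ->]|]; rewrite ?mul1r // => /negbT;
     rewrite negb_and => /orP[] /negPf ->; rewrite ?mul0r ?mulr0.
split=> [[b b0 nz]|[b b0 nz]].
  exists (low n b); first by rewrite bitn_low.
  by move=> z0; apply: nz; rewrite -(glue_low nN b) E z0 mulr0.
exists (glue [ffun _ => false] b); first by rewrite bitn_glue // n0.
rewrite E; case: ifP => [_|/negP[]]; first by rewrite mul1r.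
by apply/forallP => i; apply/implyP => _; rewrite bitn_ord ffunE.
Qed.

(** Both registers are compared with the smaller one, which the gates fit because they fit both. *)
Lemma zero_accept_cgates (c c' : circ) : cgates c = cgates c' -> circ_ok c -> circ_ok c' ->
  0 < accept_prob (@zero_state R (nqubits c)) <->
  0 < accept_prob (@zero_state R (nqubits c')).
Proof.
move=> e /andP[q ok] /andP[q' ok']; rewrite !accept_prob_gt0 -e.
set n := minn (nqubits c) (nqubits c').
have n0 : (0 < n)%N by rewrite leq_min /nqubits; apply/andP; split; lia.
have okn : all (gate_ok n) (cgates c).
  move: ok ok'; rewrite -e; elim: (cgates c) => //= g gs IH /andP[g1 gs1] /andP[g2 gs2].
  rewrite IH // andbT; case: g g1 g2 => [i|i|a b] /=; rewrite ?leq_min; [lia|lia|].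
  by move=> /and3P[-> -> ->] /and3P[-> -> _].
by rewrite (zero_amplitude_low n0 (geq_minl _ _) okn) (zero_amplitude_low n0 (geq_minr _ _) okn).
Qed.

(** * Preparation of EPR pairs *)

Lemma invsqrt2_neq0 : invsqrt2 R != 0.
Proof. by rewrite invr_eq0 sqrtr_eq0 -ltNge ltr0n. Qed.

(** The support of the state when the pairs [t >= s] are prepared: those pairs agree, while the work
    qubits and both halves of the other pairs are zero. *)
Definition epr_cond qv qm s N (b : bits N) : bool :=
  [&& [forall i : 'I_(qv + s), ~~ bitn b i], [forall t : 'I_s, ~~ bitn b (qv + qm + t)] &
    [forall t : 'I_qm, (s <= t)%N ==> (bitn b (qv + qm + t) == bitn b (qv + t))]].

Lemma epr_condP qv qm s N (b : bits N) :
  reflect [/\ forall i, (i < qv + s)%N -> ~~ bitn b i,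
    forall t, (t < s)%N -> ~~ bitn b (qv + qm + t)%N &
    forall t, (s <= t < qm)%N -> bitn b (qv + qm + t)%N = bitn b (qv + t)%N]
  (epr_cond qv qm s b).
Proof.
apply: (iffP and3P) => [[/forallP H1 /forallP H2 /forallP H3]|[H1 H2 H3]].
  split=> [i lt|t lt|t /andP[le lt]]; [exact: (H1 (Ordinal lt))|exact: (H2 (Ordinal lt))|].
  by apply/eqP; apply: (implyP (H3 (Ordinal lt))).
split; apply/forallP => i; [exact: H1|exact: H2|].
by apply/implyP => le; apply/eqP; apply: H3; rewrite le ltn_ord.
Qed.

(** Each Hadamard and CNOT multiplies the common amplitude by [invsqrt2] and enlarges the support by
    one pair. Only that the amplitude stays nonzero is recorded. *)
Lemma apply_prep_gates qv qm s N gs (a : C) :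
  (qv + qm + qm <= N)%N -> (s <= qm)%N -> a <> 0 ->
  exists2 a' : C, a' <> 0 &
  apply_gates (prep_gates qv qm s gs) (fun b : bits N => if epr_cond qv qm s b then a else 0) =
  apply_gates gs (fun b : bits N => if epr_cond qv qm 0 b then a' else 0).
Proof.
move=> leN; elim: s a => [|s IH] a les a0; first by exists a.
pose w : C := Complex (invsqrt2 R) 0.
have w0 : w <> 0 by move=> /eqP; rewrite eq_complex /= (negPf invsqrt2_neq0).
have [||a' a'0 e] := IH (w * a); first by lia.
  by apply/eqP; rewrite mulf_neq0 //; apply/eqP.
exists a' => //; rewrite -{}e /= /apply_gates /=; congr (foldl _ _ _).
apply: funext => b; set A := (qv + qm + s)%N; set B := (qv + s)%N.
have AN : (A < N)%N by rewrite /A; lia.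
have BN : (B < N)%N by rewrite /B; lia.
rewrite big_bool /=.
set b1 := setb b B _.
(* Of the two Hadamard terms, the one with [A] set vanishes, since that qubit was still zero. *)
have -> : epr_cond qv qm s.+1 (setb b1 A true) = false.
  apply/negP => /epr_condP[_ /(_ s (ltnSn s))]; rewrite bitn_setb // eqxx //.
have Hw u : Hent R u false = w by rewrite /Hent andbF.
rewrite mulr0 add0r Hw.
(* The old support wants zero at [B], where the CNOT has put the sum of the bits at [A] and [B];
   this says that pair [s] agrees. *)
have -> : epr_cond qv qm s.+1 (setb b1 A false) = epr_cond qv qm s b.
  have E i : (i < N)%N -> bitn (setb b1 A false) i =
      if i == A then false else if i == B then bitn b B (+) bitn b A else bitn b i.
    by move=> lt; rewrite !bitn_setb.
  have E' i : (i < N)%N -> i != A -> i != B -> bitn (setb b1 A false) i = bitn b i.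
    by move=> lt nA nB; rewrite E // (negPf nA) (negPf nB).
  have EB : bitn (setb b1 A false) B = bitn b B (+) bitn b A.
    by rewrite E // eqxx; case: eqP => //; rewrite /A /B; lia.
  apply/epr_condP/epr_condP => -[H1 H2 H3]; split.
  - by move=> i lt; rewrite -E' ?H1 // /A /B; lia.
  - by move=> t lt; rewrite -E' ?H2 // /A /B; lia.
  - move=> t /andP[le lt]; case: (ltnP s t) => st.
      by rewrite -(E' (qv + t)%N) -1?E' ?H3 // /A /B; lia.
    have -> : t = s by lia.
    by have := H1 B; rewrite EB -/A -/B => /(_ ltac:(rewrite /B; lia)); do 2 case: bitn.
  - move=> i lt; have [->|nB] := eqVneq i B.
      by rewrite EB -H3 ?leqnn //= addbb.
    by rewrite E' ?H1 // /A; lia.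
  - move=> t lt; have [->|ts] := eqVneq t s.
      by rewrite E // eqxx.
    by rewrite E' ?H2 // /A /B; lia.
  - by move=> t /andP[le lt]; rewrite !E' ?H3 // /A /B; lia.
by case: ifP => _; rewrite ?mulr0.
Qed.

End Amplitudes.

(** The proof qubits of [c] join the work register and their partners form the new last block, so
    the gates of [c] keep their qubit numbers. *)
Definition epr_circ (c : circ) : circ :=
  Circ (cqV c + cqM c) (cqM c) 1 (prep_gates (cqV c) (cqM c) (cqM c) (cgates c)).

Lemma epr_circ_ok c : ck c = 1%N -> circ_ok c -> circ_ok (epr_circ c).
Proof.
case: c => qv qm k gs /= -> /andP[/= qv0 ok]; rewrite /circ_ok /= addn_gt0 qv0 /=.
have : all (gate_ok (nqubits (epr_circ (Circ qv qm 1 gs)))) gs.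
  apply: sub_all ok => -[i|i|a b] /=; rewrite /nqubits /=; lia.
move=> okg; suff: forall s, (s <= qm)%N ->
    all (gate_ok (nqubits (epr_circ (Circ qv qm 1 gs)))) (prep_gates qv qm s gs) by apply.
elim=> //= s IH le; rewrite IH ?(ltnW le) // /nqubits /= andbT.
by apply/and4P; split; lia.
Qed.

(** * Positive acceptance and the two inclusions between NQMA(1) and NQP *)

Section Proofs.
Variable R : realType.
Local Notation C := (R[i]).

Definition basis_proof m (y : bits m) : bits m -> C := fun b => (b == y)%:R.

Lemma is_proof_basis m (y : bits m) : is_proof (basis_proof y).
Proof.
rewrite /is_proof (bigD1 y) //= big1 => [|b /negPf ne]; last first.
  by rewrite /basis_proof ne /sqn /= expr0n addr0.
by rewrite /basis_proof eqxx /sqn /= expr0n expr1n !addr0.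
Qed.

Lemma epr_accept_gt0 (c : circ) : ck c = 1%N -> circ_ok c ->
  0 < accept_prob (@zero_state R (nqubits (epr_circ c))) <->
  exists phis : nat -> bits (cqM c) -> C,
    (forall j, (j < 1)%N -> is_proof (phis j)) /\
    0 < accept_prob (@init_state R c phis).
Proof.
case: c => qv qm k gs /= -> /andP[/= qv0 ok].
set c := Circ qv qm 1 gs; set c' := epr_circ c.
have nN : (nqubits c <= nqubits c')%N by rewrite /nqubits /=; lia.
have Nc' : nqubits c' = (qv + qm + qm)%N by rewrite /nqubits /= mul1n.
have [a' a'0 prepE] : exists2 a' : C, a' <> 0 &
    apply_gates (cgates c') (@zero_state R (nqubits c')) =
    apply_gates gs (fun b => if epr_cond qv qm 0 b then a' else 0).
  have [|||a' a'0 e] := @apply_prep_gates R qv qm qm (nqubits c') gs 1.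
  - by rewrite /nqubits /=; lia.
  - by [].
  - by apply/eqP; rewrite oner_eq0.
  exists a' => //; rewrite -e; congr apply_gates; apply: funext => b.
  rewrite zero_stateE; congr (if _ then _ else _).
  apply/forallP/epr_condP => [H|[H1 H2 _] i].
    have Hb i : ~~ bitn b i.
      have [lt|ge] := ltnP i (nqubits c'); first exact: (H (Ordinal lt)).
      by rewrite bitn_out.
    by split=> [i _|t _|t]; rewrite ?Hb //; lia.
  have [lt|ge] := ltnP i (qv + qm)%N; first exact: H1.
  rewrite -(subnKC ge); apply: H2; have lti : (i < qv + qm + qm)%N by rewrite -Nc'.
  by lia.
pose anc (B : bits (nqubits c')) : bits qm := [ffun t : 'I_qm => bitn B (qv + qm + t)].
(* With the partner bits fixed, the proof register is forced to the same string: the slice is a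
   multiple of the run of [c] on that basis proof. *)
have glueE (z : bits (nqubits c')) b :
    apply_gates (cgates c') (@zero_state R (nqubits c')) (glue z b) =
    a' * apply_gates gs (@init_state R c (fun _ => basis_proof (anc z))) b.
  rewrite prepE (apply_gates_glue nN) // -apply_gates_scale; congr apply_gates.
  apply: funext => {}b; rewrite /init_state /= big_ord1 /basis_proof.
  have -> : epr_cond qv qm 0 (glue z b) =
      [forall i : 'I_qv, ~~ bitn b i] && (@block c b 0 == anc z).
    have gE i : (i < qv + qm)%N -> bitn (glue z b) i = bitn b i.
      by move=> lt; rewrite bitn_glue // ifT // /nqubits /=; lia.
    have gE' t : bitn (glue z b) (qv + qm + t) = bitn z (qv + qm + t).
      by rewrite bitn_glue // ifF // /nqubits /=; lia.
    have blockE t : (t < qm)%N -> bitn (@block c b 0) t = bitn b (qv + t).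
      by move=> lt; rewrite (bitn_finfun _ lt) /= mul0n addn0.
    have ancE t : (t < qm)%N -> bitn (anc z) t = bitn z (qv + qm + t).
      by move=> lt; rewrite (bitn_finfun _ lt).
    apply/epr_condP/andP => [[H1 _ H3]|[/forallP H1 /eqP e]]; split=> //.
    - by apply/forallP => i; rewrite -gE ?H1 ?addn0 // ltn_addr.
    - apply/eqP/bits_eqP => t lt; rewrite blockE // ancE // -gE' H3 //.
      by rewrite gE // ltn_add2l.
    - move=> i; rewrite addn0 => lt; rewrite gE ?ltn_addr //.
      exact: (H1 (Ordinal lt)).
    - by move=> t lt; rewrite gE' gE ?ltn_add2l // -ancE // -e blockE.
  case: forallP => _ /=; last by rewrite mulr0.
  by case: eqP; rewrite ?mulr1 ?mulr0.
rewrite accept_prob_gt0; split=> [[B B0 nz]|[phis [_ /accept_prob_gt0 [b b0 nz]]]].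
  exists (fun _ => basis_proof (anc B)); split=> [j _|]; first exact: is_proof_basis.
  apply/accept_prob_gt0; exists (low (nqubits c) B).
    by rewrite bitn_low // /nqubits /=; lia.
  by move=> z0; apply: nz; rewrite -(glue_low nN B) glueE z0 mulr0.
(* Otherwise the amplitude at [b] would vanish on all basis proofs and, by linearity, on
   [phis 0]. *)
have [y ynz] : exists y : bits qm,
    apply_gates gs (@init_state R c (fun _ => basis_proof y)) b <> 0.
  apply: contrapT => /forallNP H; apply: nz => /=.
  have -> : @init_state R c phis =
      fun b => \sum_(y : bits qm) phis 0 y * @init_state R c (fun _ => basis_proof y) b.
    apply: funext => b1; rewrite /init_state /= big_ord1; case: ifP => _; last first.
      by rewrite big1 // => y _; rewrite mulr0.
    rewrite (bigD1 (@block c b1 0)) //= big_ord1 /basis_proof eqxx mulr1 big1 ?addr0 //.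
    by move=> y ne; rewrite big_ord1 eq_sym (negPf ne) mulr0.
  rewrite apply_gates_sum big1 // => y _.
  by have /contrapT -> := H y; rewrite mulr0.
(* This writes [y] on the partners; at lower positions the subtraction truncates, but [glue]
   overwrites those bits with [b]. *)
pose z : bits (nqubits c') := [ffun j : 'I_(nqubits c') => bitn y (j - (qv + qm))].
exists (glue z b); first by rewrite bitn_glue // ifT // /nqubits /=; lia.
have ez : anc z = y.
  apply: bits_eqP => t lt; rewrite (bitn_finfun _ lt) /=.
  have ltz : (qv + qm + t < nqubits c')%N by rewrite /nqubits /=; lia.
  by rewrite (bitn_finfun _ ltz) /= addKn.
by rewrite glueE ez; apply/eqP; rewrite mulf_neq0 //; apply/eqP.
Qed.

Definition pad_circ p (c : circ) : circ := Circ p 0 1 (cgates c).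

(** A state of zero qubits is a scalar, its value at the unique empty bit string. *)
Lemma init_state_pad p (c : circ) phis b :
  @init_state R (pad_circ p c) phis b =
  phis 0 [ffun _ => false] * @zero_state R (nqubits (pad_circ p c)) b.
Proof.
rewrite zero_stateE /init_state /= big_ord1.
have -> : block b 0 = [ffun _ => false] :> bits (cqM (pad_circ p c)).
  by apply/ffunP => -[].
have -> : [forall i : 'I_p, ~~ bitn b i] = [forall i : 'I_(nqubits (pad_circ p c)), ~~ bitn b i].
  have e : nqubits (pad_circ p c) = p by rewrite /nqubits /= addn0.
  apply/forallP/forallP => H i.
    have lt : (i < p)%N by apply: leq_trans (ltn_ord i) _; rewrite e.
    exact: (H (Ordinal lt)).
  have lt : (i < nqubits (pad_circ p c))%N by apply: leq_trans (ltn_ord i) _; rewrite e.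
  exact: (H (Ordinal lt)).
by case: ifP; rewrite ?mulr1 ?mulr0.
Qed.

Lemma pad_accept_gt0 p (c : circ) phis : circ_ok c -> circ_ok (pad_circ p c) ->
  0 < accept_prob (@init_state R (pad_circ p c) phis) ->
  0 < accept_prob (@zero_state R (nqubits c)).
Proof.
move=> ok ok' /accept_prob_gt0 [b b0 nz].
apply/(zero_accept_cgates R (erefl : cgates c = cgates (pad_circ p c)) ok ok').
apply/accept_prob_gt0; exists b => // z0; apply: nz.
by rewrite (funext (init_state_pad phis)) apply_gates_scale z0 mulr0.
Qed.

Lemma accept_gt0_pad p (c : circ) : circ_ok c -> circ_ok (pad_circ p c) ->
  0 < accept_prob (@zero_state R (nqubits c)) ->
  0 < accept_prob (@init_state R (pad_circ p c) (fun _ _ => 1)).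
Proof.
move=> ok ok' /(zero_accept_cgates R (erefl : cgates c = cgates (pad_circ p c)) ok ok') H.
by rewrite (funext (init_state_pad _)) (funext (fun b => mul1r _)).
Qed.

Lemma is_proof0 : @is_proof R 0 (fun _ => 1).
Proof.
rewrite /is_proof (big_pred1 [ffun _ => false]); last first.
  by move=> b; apply/esym/eqP/ffunP => -[].
by rewrite /sqn /= expr1n expr0n addr0.
Qed.

Lemma NQMA_NQP A : NQMA R (fun _ => 1%N) A -> NQP R A.
Proof.
move=> [c [c01 [V [[[f [fP fV]] _ kV] [Vy Vn]]]]].
exists (fun x => epr_circ (V x)).
have ok x : circ_ok (V x) by have [] := decode_inv (fV x).
have acc x := epr_accept_gt0 (kV x) (ok x).
split; [|split].
- pose G x := drop (cqV (V x) + cqM (V x) + 1 + 3) (f x).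
  have fE x : f x = circ_str (cqV (V x)) (cqM (V x)) 1 (G x).
    by have [_ + _] := decode_inv (fV x); rewrite kV.
  exists (fun x => circ_str (cqV (V x) + cqM (V x)) (cqM (V x)) 1
     (prep_str (cqV (V x)) (cqM (V x)) (cqM (V x)) (G x))); split.
    exact: PolyTime_prep fP fE.
  move=> x; apply: decode_circ_str; last exact: (epr_circ_ok (kV x) (ok x)).
  by apply: gates_of_prep_str; have [_ _] := decode_inv (fV x); rewrite kV.
- move=> x xA; have [phis [pr le]] := Vy x xA; apply/acc; exists phis; split=> //.
  by apply: lt_le_trans le; have /andP[] := c01 (size x).
- move=> x xA; apply/eqP; rewrite -[_ == 0]negbK; apply/negP => nz.
  have /acc [phis [pr lt]] : 0 < accept_prob (@zero_state R (nqubits (epr_circ (V x)))).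
    by rewrite lt_def nz accept_prob_ge0.
  by have := Vn x xA phis pr; rewrite leNgt lt.
Qed.

Lemma NQP_NQMA A : NQP R A -> NQMA R (fun _ => 1%N) A.
Proof.
move=> [Q [[f [fP fQ]] [Qy Qn]]].
have ok x : circ_ok (Q x) by have [] := decode_inv (fQ x).
pose G x := drop (cqV (Q x) + cqM (Q x) + ck (Q x) + 3) (f x).
have eG x : gates_of_str (G x) = Some (cgates (Q x)) by have [] := decode_inv (fQ x).
have fE x : f x = circ_str (cqV (Q x)) (cqM (Q x)) (ck (Q x)) (G x).
  by have [] := decode_inv (fQ x).
have [P [ltP PP]] := PolyTime_pad fP fE.
pose V x := pad_circ (P (size x)) (Q x).
have okV x : circ_ok (V x).
  (* [P (size x)] exceeds the length of [f x], so it is positive and larger than every number coded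
     in [f x]. *)
  rewrite /circ_ok /= (leq_ltn_trans _ (ltP x)) //=.
  have /andP[_ okg] := ok x.
  have := eG x; rewrite /gates_of_str; case e: unary_nats => [gl|] //= eg.
  apply: parse_gates_ok eg _ okg.
  apply: sub_all (unary_nats_bound e) => n; rewrite add0n /nqubits /= addn0 => lt.
  apply: leq_trans lt _; apply: leq_trans (ltnW (ltP x)).
  by rewrite size_drop leq_subr.
pose pr x := accept_prob (@init_state R (V x) (fun _ _ => 1)).
(* The minimum ranges over finitely many positive values, and its default 1 keeps it in the required
   range when there are none. *)
exists (fun n => \big[Num.min/1]_(x : n.-tuple bool | 0 < pr x) pr x); split.
  move=> n; apply: (big_rec (fun r : R => 0 < r <= 1)); first by rewrite ltr01 lexx.
  by move=> x r p0 /andP[r0 r1]; rewrite lt_min p0 r0 ge_min r1 orbT.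
exists V; split; [split|split].
- exists (fun x => circ_str (P (size x)) 0 1 (G x)); split; first exact: PP.
  by move=> x; apply: decode_circ_str => //; apply: okV.
- by exists P, (fun _ => 0%N).
- by [].
- move=> x xA; exists (fun _ _ => 1); split=> [j _|]; first exact: is_proof0.
  have px : 0 < pr x by apply: accept_gt0_pad (Qy x xA); [apply: ok|apply: okV].
  exact: (@bigmin_le_cond _ _ _ _ (in_tuple x) (fun y => 0 < pr y) (fun y => pr y) px).
- move=> x xA phis prf; rewrite leNgt; apply/negP => /(pad_accept_gt0 (ok x) (okV x)).
  by rewrite (Qn x xA) ltxx.
Qed.

End Proofs.

Theorem theorem5p3 (R : realType) :
  (forall A : problem, EQMA R (fun _ => 1%N) A -> RQMA R (fun _ => 1%N) A) /\
  (forall A : problem, RQMA R (fun _ => 1%N) A -> NQMA R (fun _ => 1%N) A) /\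
  (forall A : problem, NQMA R (fun _ => 1%N) A <-> NQP R A).
Proof.
have half : 0 < (2^-1 : R) <= 1 by rewrite invr_gt0 ltr0n invf_le1 ?ltr0n // ler1n.
split; [|split].
- move=> A [V [Vv [Vy Vn]]]; exists V; split=> //; split=> // x xA.
  have [phis [pr le]] := Vy x xA; exists phis; split=> //.
  by apply: le_trans le; have /andP[] := half.
- by move=> A H; exists (fun _ => 2^-1).
- by move=> A; split; [apply: NQMA_NQP|apply: NQP_NQMA].
Qed.
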